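(* Let $p\in\mathbb{N}$ with $p\ge 1$, let $A,B$ be real numbers with $-1\le B<A\le 1$, and let $0\le\beta<1$. Let $f\in\mathcal{S}_p(A,B,\beta)$ have the expansion $f(z)=z^p+\sum_{n=1}^\infty a_{n+p}z^{n+p}$ in $\mathbb{D}$. Then the following hold. (i) $$|a_{p+1}|\le (A-B)(p-\beta).$$ (ii) If $A(p-\beta)-B(p-\beta+1)\le 1$ (equivalently, $A(p-\beta)-B(n-\beta-1)\le n-p-1$ for all $n\ge p+2$), then for every $n\ge p+2$, $$|a_n|\le \frac{(A-B)(p-\beta)}{n-p}.$$ (iii) If $n\ge p+2$ and $A(p-\beta)-B(n-\beta-1)>n-p-1$, then $$|a_n|\le \prod_{j=1}^{n-p}\frac{A(p-\beta)-B(p-\beta+j-1)}{j}.$$ Moreover, the inequalities in (i), (ii) and (iii) are sharp: for all admissible parameters $p,A,B,\beta$ (and each $n$) satisfying the conditions of the respective case, there is a function in $\mathcal{S}_p(A,B,\beta)$ for which equality holds.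
   Context: Let $\mathbb{D}=\{z\in\mathbb{C}:|z|<1\}$. For a natural number $p\ge 1$, $\mathcal{A}_p$ denotes the class of functions of the form $f(z)=z^p+\sum_{n=1}^\infty a_{n+p}z^{n+p}$ which are analytic and $p$-valent in $\mathbb{D}$. For $g,f$ analytic in $\mathbb{D}$, $g$ is subordinate to $f$, written $g(z)\prec f(z)$, if there exists an analytic function $\phi$ in $\mathbb{D}$ with $\phi(0)=0$ and $|\phi(z)|<1$ for $z\in\mathbb{D}$ such that $g(z)=f(\phi(z))$ for $z\in\mathbb{D}$. For $-1\le B<A\le 1$ and $0\le\beta<1$, $\mathcal{S}_p(A,B,\beta)$ denotes the class of functions $f\in\mathcal{A}_p$ satisfying $$\frac{zf'(z)}{f(z)}\prec\frac{p+\big[pB+(A-B)(p-\beta)\big]z}{1+Bz},\qquad z\in\mathbb{D}.$$ (The function $zf'(z)/f(z)$ is understood to take the value $p$ at $z=0$.) *)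

(* Defs.v *)
(* Stdlib reals with Coquelicot's complex numbers. *)
From Stdlib Require Import Reals List.
From Coquelicot Require Import Coquelicot.
Local Open Scope R_scope.

Definition unit_disc (z : C) : Prop := Cmod z < 1.

(* Complex differentiability, over the scalars [C_AbsRing] as in
   [C_derive_correct]. *)
Definition holomorphic_on_disc (f : C -> C) : Prop :=
  forall z : C, unit_disc z ->
    @ex_derive C_AbsRing C_NormedModule f z.

(* Only the values [a n] with [n >= p + 1] matter. *)
Definition has_expansion (p : nat) (a : nat -> C) (f : C -> C) : Prop :=
  forall z : C, unit_disc z ->
    @is_series C_AbsRing C_NormedModule
      (fun k : nat => (a (S k + p)%nat * z ^ (S k + p))%C)
      (f z - z ^ p)%C.

(* The entries of [s], repeated at most as often as their multiplicity, are
   solutions in the disc of [f z = w]: [f - w] is divisible by the product of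
   the factors [z - c], [c] in [s]. *)
Definition solutions (f : C -> C) (w : C) (s : list C) : Prop :=
  List.Forall unit_disc s /\
  exists h : C -> C,
    holomorphic_on_disc h /\
    forall z : C, unit_disc z ->
      (f z - w)%C = (fold_right Cmult (RtoC 1) (map (fun c => z - c) s) * h z)%C.

(* No value is taken more than [p] times, and some value is taken [p] times,
   counting multiplicities. *)
Definition p_valent (p : nat) (f : C -> C) : Prop :=
  (forall (w : C) (s : list C), solutions f w s -> (length s <= p)%nat) /\
  (exists (w : C) (s : list C), solutions f w s /\ length s = p).

Definition class_A (p : nat) (f : C -> C) : Prop :=
  holomorphic_on_disc f /\
  (exists a : nat -> C, has_expansion p a f) /\
  p_valent p f.

Definition subordinate (g f : C -> C) : Prop :=
  holomorphic_on_disc g /\ holomorphic_on_disc f /\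
  exists phi : C -> C,
    holomorphic_on_disc phi /\
    phi (RtoC 0) = RtoC 0 /\
    (forall z : C, unit_disc z -> Cmod (phi z) < 1) /\
    (forall z : C, unit_disc z -> g z = f (phi z)).

(* z f'(z) / f(z), with its value p at the removable singularity 0. *)
Definition log_quotient (p : nat) (f : C -> C) (z : C) : C :=
  if Ceq_dec z (RtoC 0) then RtoC (INR p)
  else (z * C_derive f z / f z)%C.

Definition superordinate (p : nat) (A B beta : R) (z : C) : C :=
  ((RtoC (INR p) + RtoC (INR p * B + (A - B) * (INR p - beta)) * z)
     / (RtoC 1 + RtoC B * z))%C.

(* The non-vanishing clause says that the quotient [z f' / f] is defined; it is
   explicit because division by zero is total here. *)
Definition class_S (p : nat) (A B beta : R) (f : C -> C) : Prop :=
  class_A p f /\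
  (forall z : C, unit_disc z -> z <> RtoC 0 -> f z <> RtoC 0) /\
  subordinate (log_quotient p f) (superordinate p A B beta).

(* Main.v *)
(* Write [D = (A - B) (p - beta)] and [f = z^p sum c_k z^k].  Subordination to the
   Moebius map says [G = phi H] with [phi] a Schwarz function,
   [G = sum k c_k z^k] and [H = sum (D - B k) c_k z^k].  Clunie's truncation
   argument turns this into
   [sum_{k <= m} k^2 |c_k|^2 <= sum_{k < m} (D - B k)^2 |c_k|^2], from which the
   bounds follow by induction on [m], according to the sign of
   [(D - B k)^2 - k^2].  As [phi = G / H] is a quotient of power series, Clunie's
   argument only needs the mean value property for functions with a continuous
   complex derivative.

   Equality holds for [f = z^p F (z^m)] with [F = (1 + B z)^(D / (m B))].  Its
   [p]-valence comes from [zeta = log z]: [log f] is a function of [zeta] on the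
   left half plane, its derivative [z f' / f] has positive real part, so it is
   injective there.  The solutions of [f z = w] correspond to the branches
   [lambda + 2 pi i k] of [log w], and adding [2 pi i] to [zeta] changes [k]
   by [p], so distinct solutions have distinct [k] modulo [p]. *)
Require Import Defs.
From Stdlib Require Import Reals List.
From Stdlib Require Import Arith ZArith Lra Lia Permutation Classical.
From Coquelicot Require Import Coquelicot.
Open Scope R_scope.

(** Only D and B matter, because the superordinate function is p + D w / (1 + B w). Comparing D - B
    k with k decides the case: D - B <= 1 makes every term with k >= 1 nonpositive, so only the term
    D^2 at k = 0 survives. The condition of (iii) makes all the terms involved positive, and |c_k|
    is then compared with the numbers given by (k + 1) b_{k+1} = (D - B k) b_k, the Taylor
    coefficients of (1 + B z)^(D / B). The extremal exponent is divided by m so that z f' / f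
    becomes the superordinate function at z^m. The first nontrivial coefficient is then D / m, at
    z^(p + m): hence m = n - p for (ii), and m = 1 for (i) and (iii). F is handled through the
    equation (1 + B z) F' = delta F, which covers B = 0 without a separate case. The positive real
    part of z f' / f rests on D <= (1 - B) p, a consequence of A <= 1 and 0 <= beta. Multiplicities
    are expressed by divisibility. For w = 0 all solutions lie at the origin and are counted by
    comparing powers of z; for w <> 0 they are simple, since z f' / f never vanishes. *)

Ltac cring := cbv beta; ring.
(* On C, [field] may stop at an equation between identical normal forms. *)
Ltac cfield := cbv beta; field || (field_simplify_eq; [reflexivity | ]).

(** * Complex derivatives *)

(** The epsilon-delta form of [is_derive] over C. The non-strict inequality includes w = z, and the
    estimates for power series and for curves are made directly in this form. *)
Definition Cder (f : C -> C) (z l : C) : Prop :=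
  forall eps : R, 0 < eps -> exists delta : R, 0 < delta /\
    forall w : C, Cmod (w - z) < delta ->
      Cmod (f w - f z - (w - z) * l) <= eps * Cmod (w - z).

Definition Ccont (f : C -> C) (z : C) : Prop :=
  forall eps : R, 0 < eps -> exists delta : R, 0 < delta /\
    forall w : C, Cmod (w - z) < delta -> Cmod (f w - f z) < eps.

Lemma is_derive_Cder (f : C -> C) (z l : C) :
  @is_derive C_AbsRing C_NormedModule f z l <-> Cder f z l.
Proof.
  split.
  - intros [_ H] eps Heps.
    destruct (H z (fun P HP => HP) (mkposreal eps Heps)) as [d Hd].
    exists d. split; [apply cond_pos|]. intros w Hw. exact (Hd w Hw).
  - intros H. split.
    + apply is_linear_scal_l.
    + intros x Hx.
      (* [is_derive] speaks of every limit x of the filter [locally z]; z is the only one. *)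
      assert (x = z) as ->.
      { symmetry.
        exact (@is_filter_lim_locally_unique C_AbsRing (AbsRing_NormedModule C_AbsRing) z x Hx). }
      intros [eps Heps]. destruct (H eps Heps) as [d [Hd Hw]].
      exists (mkposreal d Hd). intros w Hb. exact (Hw w Hb).
Qed.

Lemma Cder_ext_loc (f g : C -> C) (z l : C) (d : R) :
  0 < d -> (forall w : C, Cmod (w - z) < d -> f w = g w) ->
  Cder f z l -> Cder g z l.
Proof.
  intros Hd Hfg H. intros eps Heps.
  destruct (H eps Heps) as [d' [Hd' Hw]].
  exists (Rmin d d'). split; [now apply Rmin_pos|].
  intros w Hwz.
  assert (H0 : Cmod (z - z) < d).
  { replace (z - z)%C with (RtoC 0) by ring. rewrite Cmod_0. lra. }
  rewrite <- (Hfg w), <- (Hfg z); trivial.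
  - apply Hw. eapply Rlt_le_trans; [exact Hwz|apply Rmin_r].
  - eapply Rlt_le_trans; [exact Hwz|apply Rmin_l].
Qed.

Lemma Cder_C_derive (f : C -> C) (z l : C) : Cder f z l -> C_derive f z = l.
Proof. intros H. apply is_C_derive_unique. now apply is_derive_Cder. Qed.

Lemma Cder_unique (f : C -> C) (z l l' : C) : Cder f z l -> Cder f z l' -> l = l'.
Proof.
  intros H H'. rewrite <- (Cder_C_derive _ _ _ H). now apply Cder_C_derive.
Qed.

Lemma Cder_const (c z : C) : Cder (fun _ => c) z (RtoC 0).
Proof.
  intros eps Heps. exists 1. split; [lra|]. intros w _.
  replace (c - c - (w - z) * 0)%C with (RtoC 0) by ring. rewrite Cmod_0.
  apply Rmult_le_pos; [lra|apply Cmod_ge_0].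
Qed.

Lemma Cder_id (z : C) : Cder (fun w => w) z (RtoC 1).
Proof.
  intros eps Heps. exists 1. split; [lra|]. intros w _.
  replace (w - z - (w - z) * 1)%C with (RtoC 0) by ring. rewrite Cmod_0.
  apply Rmult_le_pos; [lra|apply Cmod_ge_0].
Qed.

Lemma Cder_plus (f g : C -> C) (z l l' : C) :
  Cder f z l -> Cder g z l' -> Cder (fun w => f w + g w)%C z (l + l')%C.
Proof. intros H H'. apply is_derive_Cder.
  apply @is_derive_plus; now apply is_derive_Cder. Qed.

Lemma Cder_lipschitz (f : C -> C) (z l : C) : Cder f z l ->
  exists d : R, 0 < d /\ forall w : C, Cmod (w - z) < d ->
    Cmod (f w - f z) <= (Cmod l + 1) * Cmod (w - z).
Proof.
  intros H. destruct (H 1 Rlt_0_1) as [d [Hd Hw]].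
  exists d. split; trivial. intros w Hwz. specialize (Hw w Hwz).
  replace (f w - f z)%C with ((f w - f z - (w - z) * l) + (w - z) * l)%C by ring.
  eapply Rle_trans; [apply Cmod_triangle|]. rewrite Cmod_mult. lra.
Qed.

Lemma Cder_cont (f : C -> C) (z l : C) : Cder f z l -> Ccont f z.
Proof.
  intros H eps Heps. destruct (Cder_lipschitz _ _ _ H) as [d [Hd Hw]].
  assert (Hl := Cmod_ge_0 l).
  exists (Rmin d (eps / (Cmod l + 1))). split.
  { apply Rmin_pos; trivial. apply Rdiv_lt_0_compat; lra. }
  intros w Hwz. eapply Rle_lt_trans.
  - apply Hw. eapply Rlt_le_trans; [exact Hwz|apply Rmin_l].
  - apply Rlt_le_trans with ((Cmod l + 1) * (eps / (Cmod l + 1))).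
    + apply Rmult_lt_compat_l; [lra|].
      eapply Rlt_le_trans; [exact Hwz|apply Rmin_r].
    + right. field. lra.
Qed.

Lemma Cder_comp (f g : C -> C) (z l l' : C) :
  Cder f (g z) l -> Cder g z l' -> Cder (fun w => f (g w)) z (l * l')%C.
Proof.
  intros Hf Hg. intros eps Heps.
  set (M := Cmod l' + 1). assert (HM : 0 < M) by (generalize (Cmod_ge_0 l'); unfold M; lra).
  set (N := Cmod l + 1). assert (HN : 0 < N) by (generalize (Cmod_ge_0 l); unfold N; lra).
  destruct (Cder_lipschitz _ _ _ Hg) as [d1 [Hd1 H1]]. fold M in H1.
  destruct (Hg (eps / 2 / N)) as [d2 [Hd2 H2]].
  { repeat apply Rdiv_lt_0_compat; lra. }
  destruct (Hf (eps / 2 / M)) as [d3 [Hd3 H3]].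
  { repeat apply Rdiv_lt_0_compat; lra. }
  exists (Rmin (Rmin d1 d2) (d3 / M)). split.
  { repeat apply Rmin_pos; trivial. now apply Rdiv_lt_0_compat. }
  intros w Hwz.
  assert (W1 : Cmod (w - z) < d1)
    by (eapply Rlt_le_trans; [exact Hwz|]; eapply Rle_trans; [apply Rmin_l|apply Rmin_l]).
  assert (W2 : Cmod (w - z) < d2)
    by (eapply Rlt_le_trans; [exact Hwz|]; eapply Rle_trans; [apply Rmin_l|apply Rmin_r]).
  assert (W3 : Cmod (w - z) < d3 / M)
    by (eapply Rlt_le_trans; [exact Hwz|apply Rmin_r]).
  specialize (H1 w W1). specialize (H2 w W2).
  assert (W4 : Cmod (g w - g z) < d3).
  { eapply Rle_lt_trans; [exact H1|].
    replace d3 with (M * (d3 / M)) by (field; lra). now apply Rmult_lt_compat_l. }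
  specialize (H3 _ W4).
  replace (f (g w) - f (g z) - (w - z) * (l * l'))%C with
    ((f (g w) - f (g z) - (g w - g z) * l) + (g w - g z - (w - z) * l') * l)%C by ring.
  eapply Rle_trans; [apply Cmod_triangle|]. rewrite Cmod_mult.
  replace (eps * Cmod (w - z)) with
    (eps / 2 / M * (M * Cmod (w - z)) + eps / 2 / N * Cmod (w - z) * N) by (field; lra).
  apply Rplus_le_compat.
  - eapply Rle_trans; [exact H3|]. apply Rmult_le_compat_l; trivial.
    left. repeat apply Rdiv_lt_0_compat; lra.
  - apply Rmult_le_compat; try apply Cmod_ge_0; trivial. unfold N; lra.
Qed.

Lemma Cder_mult (f g : C -> C) (z l l' : C) :
  Cder f z l -> Cder g z l' -> Cder (fun w => f w * g w)%C z (l * g z + f z * l')%C.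
Proof.
  intros Hf Hg. intros eps Heps.
  set (M := Cmod (f z) + 1). assert (HM : 0 < M) by (generalize (Cmod_ge_0 (f z)); unfold M; lra).
  set (N := Cmod (g z) + 1). assert (HN : 0 < N) by (generalize (Cmod_ge_0 (g z)); unfold N; lra).
  set (K := Cmod l + 1). assert (HK : 0 < K) by (generalize (Cmod_ge_0 l); unfold K; lra).
  destruct (Cder_lipschitz _ _ _ Hf) as [d1 [Hd1 H1]]. fold K in H1.
  destruct (Hf (eps / 3 / N)) as [d2 [Hd2 H2]].
  { repeat apply Rdiv_lt_0_compat; lra. }
  destruct (Hg (eps / 3 / M)) as [d3 [Hd3 H3]].
  { repeat apply Rdiv_lt_0_compat; lra. }
  destruct (Cder_cont _ _ _ Hg (eps / 3 / K)) as [d4 [Hd4 H4]].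
  { repeat apply Rdiv_lt_0_compat; lra. }
  exists (Rmin (Rmin d1 d2) (Rmin d3 d4)). split.
  { repeat apply Rmin_pos; trivial. }
  intros w Hwz.
  apply Rmin_Rgt_l in Hwz. destruct Hwz as [W12 W34].
  apply Rmin_Rgt_l in W12. destruct W12 as [W1 W2].
  apply Rmin_Rgt_l in W34. destruct W34 as [W3 W4].
  specialize (H1 w W1). specialize (H2 w W2). specialize (H3 w W3). specialize (H4 w W4).
  replace (f w * g w - f z * g z - (w - z) * (l * g z + f z * l'))%C with
    ((f w - f z - (w - z) * l) * g z + (f z * (g w - g z - (w - z) * l')
      + (f w - f z) * (g w - g z)))%C by ring.
  eapply Rle_trans; [apply Cmod_triangle|].
  eapply Rle_trans; [apply Rplus_le_compat_l; apply Cmod_triangle|]. rewrite !Cmod_mult.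
  replace (eps * Cmod (w - z)) with
    (eps / 3 / N * Cmod (w - z) * N + (M * (eps / 3 / M * Cmod (w - z))
      + (K * Cmod (w - z)) * (eps / 3 / K))) by (field; lra).
  repeat apply Rplus_le_compat; apply Rmult_le_compat; try apply Cmod_ge_0; trivial;
    try (unfold M, N; lra).
Qed.

Lemma Cder_opp (f : C -> C) (z l : C) : Cder f z l -> Cder (fun w => - f w)%C z (- l)%C.
Proof. intros H. apply is_derive_Cder. apply @is_derive_opp. now apply is_derive_Cder. Qed.

Lemma Cder_minus (f g : C -> C) (z l l' : C) :
  Cder f z l -> Cder g z l' -> Cder (fun w => f w - g w)%C z (l - l')%C.
Proof. intros H H'. apply Cder_plus; trivial. now apply Cder_opp. Qed.

Lemma Cder_eq (f : C -> C) (z l l' : C) : Cder f z l -> l = l' -> Cder f z l'.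
Proof. now intros H <-. Qed.

Lemma Cder_inv_id (z : C) : z <> RtoC 0 -> Cder Cinv z (- / (z * z))%C.
Proof.
  intros Hz. intros eps Heps.
  assert (Hm := proj1 (Cmod_gt_0 z) Hz). set (m := Cmod z) in *.
  (* The error is |w - z|^2 / (|w| m^2). The first bound gives |w| >= m / 2, the second then makes
     the error at most eps |w - z|. *)
  exists (Rmin (m / 2) (eps * m ^ 3 / 2)). split.
  { apply Rmin_pos; [lra|]. apply Rdiv_lt_0_compat; [|lra].
    apply Rmult_lt_0_compat; trivial. now apply pow_lt. }
  intros w Hwz. apply Rmin_Rgt_l in Hwz. destruct Hwz as [W1 W2].
  assert (Hw : m / 2 <= Cmod w).
  { assert (m <= Cmod w + Cmod (w - z)); [|lra].
    unfold m. rewrite <- (Cmod_opp (w - z)).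
    replace z with (w + - (w - z))%C at 1 by ring. apply Cmod_triangle. }
  assert (Hw0 : w <> RtoC 0).
  { apply Cmod_gt_0. lra. }
  replace (/ w - / z - (w - z) * - / (z * z))%C with ((w - z) * (w - z) / (w * (z * z)))%C.
  2:{ cfield. split; assumption. }
  assert (Hwzz : (w * (z * z))%C <> RtoC 0).
  { repeat apply Cmult_neq_0; assumption. }
  rewrite Cmod_div; trivial. rewrite !Cmod_mult. fold m.
  set (x := Cmod (w - z)) in *. set (y := Cmod w) in *.
  assert (Hx : 0 <= x) by apply Cmod_ge_0.
  apply Rmult_le_reg_r with (y * (m * m)).
  { apply Rmult_lt_0_compat; nra. }
  unfold Rdiv. rewrite Rmult_assoc, Rinv_l.
  2:{ apply Rgt_not_eq. apply Rmult_lt_0_compat; nra. }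
  apply Rle_trans with (x * (eps * m ^ 3 / 2)).
  { rewrite Rmult_1_r. apply Rmult_le_compat_l; lra. }
  replace (eps * x * (y * (m * m))) with (x * (eps * y * (m * m))) by ring.
  apply Rmult_le_compat_l; trivial.
  assert (0 <= eps * (m * m)) by (apply Rmult_le_pos; nra). simpl. nra.
Qed.

Lemma Cder_inv (f : C -> C) (z l : C) : f z <> RtoC 0 ->
  Cder f z l -> Cder (fun w => / f w)%C z (- / (f z * f z) * l)%C.
Proof. intros Hz H. apply (Cder_comp Cinv f); trivial. now apply Cder_inv_id. Qed.

Lemma Cder_scal (f : C -> C) (c z l : C) : Cder f z l -> Cder (fun w => c * f w)%C z (c * l)%C.
Proof.
  intros H. eapply Cder_eq; [apply Cder_mult; [apply Cder_const|exact H]|cring].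
Qed.

Lemma Cder_pow (n : nat) (z : C) :
  Cder (fun w => w ^ n)%C z (RtoC (INR n) * z ^ (n - 1))%C.
Proof.
  induction n as [|n IH].
  - eapply Cder_eq; [exact (Cder_const (RtoC 1) z)|simpl; cring].

  - eapply Cder_eq.
    + exact (Cder_mult (fun w => w) (fun w => w ^ n)%C z _ _ (Cder_id z) IH).
    + destruct n as [|n]; [simpl; cring|].
      replace (S (S n) - 1)%nat with (S n) by lia. replace (S n - 1)%nat with n by lia.
      rewrite (S_INR (S n)), (S_INR n), !RtoC_plus, Cpow_S. cring.
Qed.

(** * Power series in the unit disc *)

Definition is_CSeries (u : nat -> C) (l : C) : Prop :=
  @is_series C_AbsRing C_NormedModule u l.

Lemma Re_sum_n (u : nat -> C) (n : nat) :
  Re (@sum_n C_AbelianMonoid u n) = sum_n (fun k => Re (u k)) n.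
Proof.
  induction n as [|n IH]; [now rewrite !sum_O|].
  rewrite !sum_Sn. rewrite <- IH. reflexivity.
Qed.

Lemma Im_sum_n (u : nat -> C) (n : nat) :
  Im (@sum_n C_AbelianMonoid u n) = sum_n (fun k => Im (u k)) n.
Proof.
  induction n as [|n IH]; [now rewrite !sum_O|].
  rewrite !sum_Sn. rewrite <- IH. reflexivity.
Qed.

Lemma is_CSeries_Re_Im (u : nat -> C) (l : C) :
  is_CSeries u l <->
  is_series (fun n => Re (u n)) (Re l) /\ is_series (fun n => Im (u n)) (Im l).
Proof.
  split.
  - intros H. split; apply filterlim_locally; intros eps;
      destruct (proj1 (filterlim_locally _ _) H eps) as [N HN];
      exists N; intros n Hn; destruct (HN n Hn) as [H1 H2];
      rewrite <- ?Re_sum_n, <- ?Im_sum_n; assumption.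
  - intros [H1 H2]. apply filterlim_locally. intros eps.
    destruct (proj1 (filterlim_locally _ _) H1 eps) as [N1 HN1].
    destruct (proj1 (filterlim_locally _ _) H2 eps) as [N2 HN2].
    exists (max N1 N2). intros n Hn. split.
    + specialize (HN1 n ltac:(lia)). rewrite <- Re_sum_n in HN1. exact HN1.
    + specialize (HN2 n ltac:(lia)). rewrite <- Im_sum_n in HN2. exact HN2.
Qed.

(** A total function, like the real [Series]; its value is meaningful only where the series
    converges. *)
Definition CSeries (u : nat -> C) : C :=
  (Series (fun n => Re (u n)), Series (fun n => Im (u n))).

Lemma is_CSeries_unique (u : nat -> C) (l : C) : is_CSeries u l -> CSeries u = l.
Proof.
  intros H. apply is_CSeries_Re_Im in H. destruct H as [H1 H2].
  unfold CSeries. rewrite (is_series_unique _ _ H1), (is_series_unique _ _ H2).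
  now destruct l.
Qed.

Lemma is_CSeries_ext (u v : nat -> C) (l : C) :
  (forall n, u n = v n) -> is_CSeries u l -> is_CSeries v l.
Proof. apply is_series_ext. Qed.

Lemma is_CSeries_val (u : nat -> C) (l l' : C) : l = l' -> is_CSeries u l -> is_CSeries u l'.
Proof. now intros <-. Qed.

Lemma is_CSeries_plus (u v : nat -> C) (l m : C) :
  is_CSeries u l -> is_CSeries v m -> is_CSeries (fun n => u n + v n)%C (l + m)%C.
Proof. exact (@is_series_plus C_AbsRing C_NormedModule u v l m). Qed.

Lemma is_CSeries_scal (c : C) (u : nat -> C) (l : C) :
  is_CSeries u l -> is_CSeries (fun n => c * u n)%C (c * l)%C.
Proof. exact (@is_series_scal C_AbsRing C_NormedModule c u l). Qed.

Lemma is_CSeries_minus (u v : nat -> C) (l m : C) :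
  is_CSeries u l -> is_CSeries v m -> is_CSeries (fun n => u n - v n)%C (l - m)%C.
Proof. exact (@is_series_minus C_AbsRing C_NormedModule u v l m). Qed.

Lemma is_CSeries_incr (u : nat -> C) (l : C) :
  is_CSeries u l -> is_CSeries (fun n => u (S n)) (l - u 0%nat)%C.
Proof.
  intros H. apply (@is_series_incr_1 C_AbsRing C_NormedModule u).
  apply (is_CSeries_val _ l); trivial. change (l = (l - u 0%nat + u 0%nat)%C). ring.
Qed.

Lemma is_CSeries_decr (u : nat -> C) (l : C) :
  is_CSeries (fun n => u (S n)) l -> is_CSeries u (u 0%nat + l)%C.
Proof.
  intros H. apply (@is_series_decr_1 C_AbsRing C_NormedModule u).
  apply (is_CSeries_val _ l); trivial.
  change (l = (u 0%nat + l + - u 0%nat)%C). ring.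
Qed.

Lemma is_CSeries_le (u : nat -> C) (b : nat -> R) :
  (forall n, Cmod (u n) <= b n) -> ex_series b -> is_CSeries u (CSeries u).
Proof.
  intros H Hb.
  destruct (@ex_series_le C_AbsRing C_CompleteNormedModule u b H Hb) as [l Hl].
  change (is_CSeries u l) in Hl. now rewrite (is_CSeries_unique _ _ Hl).
Qed.

Lemma Cmod_CSeries_le (u : nat -> C) (b : nat -> R) (l : C) :
  (forall n, Cmod (u n) <= b n) -> ex_series b -> is_CSeries u l -> Cmod l <= Series b.
Proof.
  intros H Hb Hl. apply le_epsilon. intros eps Heps.
  destruct (proj1 (@filterlim_locally_ball_norm C_AbsRing _ C_NormedModule _ _ _ _) Hl
    (mkposreal eps Heps)) as [N HN].
  specialize (HN N (le_n N)).
  change (Cmod (@sum_n C_AbelianMonoid u N - l) < eps) in HN.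
  assert (H1 : Cmod (@sum_n C_AbelianMonoid u N) <= Series b).
  { apply Rle_trans with (sum_n b N).
    - clear -H. induction N as [|N IH]; [rewrite !sum_O; apply H|].
      rewrite !sum_Sn. eapply Rle_trans; [apply Cmod_triangle|].
      now apply Rplus_le_compat.
    - apply (is_lim_seq_incr_compare (sum_n b)).
      + exact (Series_correct _ Hb).
      + intros n. rewrite sum_Sn. unfold plus; simpl.
        assert (0 <= b (S n)); [|lra].
        eapply Rle_trans; [apply Cmod_ge_0|apply H]. }
  replace l with (@sum_n C_AbelianMonoid u N - (@sum_n C_AbelianMonoid u N - l))%C by ring.
  eapply Rle_trans; [apply Cmod_triangle|]. rewrite Cmod_opp. lra.
Qed.

(* Equivalent to the convergence of [sum a n z^n] for [|z| < 1]. *)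
Definition CV_disc (a : nat -> C) : Prop :=
  forall r : R, 0 <= r < 1 -> exists M : R, forall n : nat, Cmod (a n) * r ^ n <= M.

Definition CPSeries (a : nat -> C) (z : C) : C := CSeries (fun n => a n * z ^ n)%C.

(** Convergence at the real point q = (r + 1) / 2 bounds the partial sums, hence each term, as a
    difference of two of them. The origin is left out of the hypothesis because the lemma is applied
    to f z / z^p. *)
Lemma CV_disc_of_is_CSeries (a : nat -> C) (f : C -> C) :
  (forall z, z <> RtoC 0 -> Cmod z < 1 -> is_CSeries (fun n => a n * z ^ n)%C (f z)) -> CV_disc a.
Proof.
  intros H r Hr. set (q := (r + 1) / 2). assert (Hq : 0 < q < 1) by (unfold q; lra).
  assert (Hr1 : Cmod (RtoC q) < 1) by (rewrite Cmod_R, Rabs_pos_eq; lra).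
  assert (Hq0 : RtoC q <> RtoC 0).
  { apply Cmod_gt_0. rewrite Cmod_R, Rabs_pos_eq; lra. }
  specialize (H _ Hq0 Hr1).
  destruct (@filterlim_bounded C_AbsRing C_NormedModule _ (ex_intro _ _ H)) as [M HM].
  exists (2 * M). intros n.
  apply Rle_trans with (Cmod (a n * RtoC q ^ n)).
  { rewrite Cmod_mult, Cmod_pow, Cmod_R, Rabs_pos_eq by lra.
    apply Rmult_le_compat_l; [apply Cmod_ge_0|]. apply pow_incr. unfold q. lra. }
  assert (HM0 : 0 <= M) by (eapply Rle_trans; [apply Cmod_ge_0|apply (HM 0%nat)]).
  destruct n as [|n].
  - specialize (HM 0%nat). rewrite sum_O in HM.
    change (Cmod (a 0%nat * RtoC q ^ 0) <= M) in HM. lra.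
  - assert (H0 := HM n). specialize (HM (S n)). rewrite sum_Sn in HM.
    set (s := sum_n _ n) in *. set (t := (a (S n) * RtoC q ^ S n)%C) in *.
    change (Cmod (s + t) <= M) in HM. change (Cmod s <= M) in H0.
    replace t with ((s + t) + - s)%C by ring.
    eapply Rle_trans; [apply Cmod_triangle|]. rewrite Cmod_opp. lra.
Qed.

(** Passing to the moduli of the coefficients makes the real theory of [CV_radius] available, both
    for absolute convergence and for the derived series. *)
Lemma CV_disc_radius (a : nat -> C) :
  CV_disc a <-> Rbar_le 1 (CV_radius (fun n => Cmod (a n))).
Proof.
  split.
  - intros H.
    assert (H1 : forall r, 0 <= r < 1 -> Rbar_le r (CV_radius (fun n => Cmod (a n)))).
    { intros r Hr. apply (CV_radius_bounded (fun n => Cmod (a n))).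
      destruct (H r Hr) as [M HM]. exists M. intros n.
      rewrite Rabs_pos_eq; [apply HM|].
      apply Rmult_le_pos; [apply Cmod_ge_0|apply pow_le; lra]. }
    destruct (CV_radius (fun n => Cmod (a n))) as [x| |]; simpl in *; trivial.
    + apply Rnot_lt_le. intros Hx.
      destruct (Rle_lt_dec 0 x) as [H0|H0].
      * specialize (H1 ((x + 1) / 2) ltac:(lra)). lra.
      * specialize (H1 0 ltac:(lra)). lra.
    + exact (H1 0 ltac:(lra)).
  - intros H r Hr.
    assert (Hs : ex_series (fun n => Rabs (Cmod (a n) * r ^ n))).
    { apply CV_disk_inside. rewrite Rabs_pos_eq by lra.
      eapply Rbar_lt_le_trans; [|exact H]. simpl. lra. }
    apply ex_series_Rabs in Hs.
    destruct (@filterlim_bounded R_AbsRing R_NormedModule (fun n => Cmod (a n) * r ^ n))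
      as [M HM].
    { exists 0. exact (ex_series_lim_0 _ Hs). }
    exists M. intros n. eapply Rle_trans; [apply Rle_abs|apply HM].
Qed.

Lemma CV_disc_abs (a : nat -> C) (r : R) :
  CV_disc a -> 0 <= r < 1 -> ex_series (fun n => Cmod (a n) * r ^ n).
Proof.
  intros H Hr. apply CV_disc_radius in H.
  apply ex_series_Rabs. apply CV_disk_inside. rewrite Rabs_pos_eq by lra.
  eapply Rbar_lt_le_trans; [|exact H]. simpl. lra.
Qed.

Lemma CPSeries_correct (a : nat -> C) (z : C) :
  CV_disc a -> Cmod z < 1 -> is_CSeries (fun n => a n * z ^ n)%C (CPSeries a z).
Proof.
  intros H Hz. apply is_CSeries_le with (fun n => Cmod (a n) * Cmod z ^ n).
  - intros n. rewrite Cmod_mult, Cmod_pow. lra.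
  - apply CV_disc_abs; trivial. split; trivial. apply Cmod_ge_0.
Qed.

Definition CPS_derive (a : nat -> C) (n : nat) : C := (RtoC (INR (S n)) * a (S n))%C.

Lemma CV_disc_derive (a : nat -> C) : CV_disc a -> CV_disc (CPS_derive a).
Proof.
  intros H. apply CV_disc_radius. apply CV_disc_radius in H. rewrite <- CV_radius_derive in H.
  rewrite (CV_radius_ext _ (PS_derive (fun n => Cmod (a n)))); trivial.
  intros n. unfold CPS_derive, PS_derive. rewrite Cmod_mult, Cmod_R, Rabs_pos_eq; trivial.
  apply pos_INR.
Qed.

Lemma CV_disc_plus (a b : nat -> C) : CV_disc a -> CV_disc b -> CV_disc (fun n => a n + b n)%C.
Proof.
  intros Ha Hb r Hr. destruct (Ha r Hr) as [M HM], (Hb r Hr) as [N HN].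
  exists (M + N). intros n. specialize (HM n). specialize (HN n).
  assert (0 <= r ^ n) by (apply pow_le; lra).
  assert (Ht := Cmod_triangle (a n) (b n)). nra.
Qed.

Lemma CV_disc_scal (c : C) (a : nat -> C) : CV_disc a -> CV_disc (fun n => c * a n)%C.
Proof.
  intros Ha r Hr. destruct (Ha r Hr) as [M HM].
  exists (Cmod c * M). intros n. rewrite Cmod_mult, Rmult_assoc.
  apply Rmult_le_compat_l; [apply Cmod_ge_0|apply HM].
Qed.

Lemma CV_disc_ext (a b : nat -> C) : (forall n, a n = b n) -> CV_disc a -> CV_disc b.
Proof.
  intros H Ha r Hr. destruct (Ha r Hr) as [M HM]. exists M. intros n.
  rewrite <- H. apply HM.
Qed.

(* Passing to the radius [(r + 1) / 2 >= 1/2] absorbs the lost factor. *)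
Lemma CV_disc_shift (k : nat) (a : nat -> C) : CV_disc a -> CV_disc (fun n => a (n + k)%nat).
Proof.
  intros Ha. induction k as [|k IH].
  { apply (CV_disc_ext a); trivial. intros n. now rewrite Nat.add_0_r. }
  intros r Hr. destruct (IH ((r + 1) / 2) ltac:(lra)) as [M HM].
  exists (2 * M). intros n. specialize (HM (S n)). simpl in HM.
  replace (n + S k)%nat with (S (n + k)) by lia.
  assert (H1 : r ^ n <= ((r + 1) / 2) ^ n) by (apply pow_incr; lra).
  assert (H2 : 0 <= r ^ n) by (apply pow_le; lra).
  assert (H3 := Cmod_ge_0 (a (S (n + k)))).
  set (u := Cmod _) in *. set (x := r ^ n) in *. set (y := _ ^ n) in *.
  assert (u * x <= u * y) by nra.
  assert (0 <= u * y) by nra. nra.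
Qed.

Lemma CV_disc_unshift (a : nat -> C) : CV_disc (fun n => a (S n)) -> CV_disc a.
Proof.
  intros Ha r Hr. destruct (Ha r Hr) as [M HM]. exists (Rmax (Cmod (a 0%nat)) M).
  intros [|n].
  - simpl. rewrite Rmult_1_r. apply Rmax_l.
  - eapply Rle_trans; [|apply Rmax_r]. specialize (HM n). simpl.
    assert (0 <= Cmod (a (S n)) * r ^ n).
    { apply Rmult_le_pos; [apply Cmod_ge_0|apply pow_le; lra]. }
    replace (Cmod (a (S n)) * (r * r ^ n)) with (r * (Cmod (a (S n)) * r ^ n)) by ring.
    nra.
Qed.

(** The remainder e_n of the power n satisfies e_{n+1} = w e_n + n z^(n-1) (w - z)^2. The factors in
    the bound are those of the second derivative, so that the bounds sum to a convergent series. *)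
Lemma pow_taylor2 (w z : C) (r : R) (n : nat) : Cmod w <= r -> Cmod z <= r ->
  Cmod (w ^ S (S n) - z ^ S (S n) - (w - z) * (RtoC (INR (S (S n))) * z ^ S n))
  <= INR (S n) * INR (S (S n)) * r ^ n * (Cmod (w - z)) ^ 2.
Proof.
  intros Hw Hz.
  assert (Hr : 0 <= r) by (eapply Rle_trans; [apply Cmod_ge_0|exact Hw]).
  induction n as [|n IH].
  - replace (w ^ 2 - z ^ 2 - (w - z) * (RtoC (INR 2) * z ^ 1))%C with ((w - z) ^ 2)%C.
    + rewrite Cmod_pow. simpl. assert (H := pow2_ge_0 (Cmod (w - z))). simpl in H. lra.
    + simpl. rewrite RtoC_plus. ring.
  - set (e := (w ^ S (S n) - z ^ S (S n)
      - (w - z) * (RtoC (INR (S (S n))) * z ^ S n))%C) in *.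
    replace (w ^ S (S (S n)) - z ^ S (S (S n))
      - (w - z) * (RtoC (INR (S (S (S n)))) * z ^ S (S n)))%C
      with (w * e + RtoC (INR (S (S n))) * z ^ S n * (w - z) ^ 2)%C.
    2:{ unfold e. rewrite (S_INR (S (S n))), RtoC_plus.
        rewrite !(Cpow_S w), !(Cpow_S z). ring. }
    eapply Rle_trans; [apply Cmod_triangle|].
    rewrite !Cmod_mult, !Cmod_pow, Cmod_R, Rabs_pos_eq by apply pos_INR.
    set (x := Cmod (w - z) ^ 2) in *. set (N := INR (S (S n))) in *.
    replace (INR (S (S (S n)))) with (N + 1) by (unfold N; rewrite (S_INR (S (S n))); ring).
    assert (HN : INR (S n) = N - 1) by (unfold N; rewrite (S_INR (S n)); ring).
    rewrite HN in IH.
    assert (HN1 : 2 <= N) by (unfold N; rewrite !S_INR; generalize (pos_INR n); lra).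
    assert (Hx : 0 <= x) by apply pow2_ge_0.
    assert (Hzn : Cmod z ^ S n <= r ^ S n) by (apply pow_incr; split; [apply Cmod_ge_0|exact Hz]).
    assert (Hrn : 0 <= r ^ n) by now apply pow_le.
    apply Rle_trans with (r * ((N - 1) * N * r ^ n * x) + N * r ^ S n * x).
    + apply Rplus_le_compat.
      * apply Rmult_le_compat; try apply Cmod_ge_0; assumption.
      * apply Rmult_le_compat_r; trivial. apply Rmult_le_compat_l; lra.
    + simpl. set (y := r * r ^ n). assert (Hy : 0 <= y) by (unfold y; nra).
      replace (r * ((N - 1) * N * r ^ n * x)) with ((N - 1) * N * (y * x)) by (unfold y; ring).
      assert (0 <= y * x) by nra. nra.
Qed.

(** Summing the bounds of [pow_taylor2] gives an error of at most M |w - z|^2, where M is the sum of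
    the twice derived series, taken with moduli, at a radius r between |z| and 1. *)
Lemma CPSeries_der (a : nat -> C) (z : C) :
  CV_disc a -> Cmod z < 1 -> Cder (CPSeries a) z (CPSeries (CPS_derive a) z).
Proof.
  intros Ha Hz.
  set (r := (Cmod z + 1) / 2).
  assert (Hz0 := Cmod_ge_0 z).
  assert (Hr : 0 <= r < 1) by (unfold r; lra).
  assert (HM := CV_disc_abs _ r (CV_disc_derive _ (CV_disc_derive _ Ha)) Hr).
  set (b := fun n => Cmod (CPS_derive (CPS_derive a) n) * r ^ n) in HM.
  set (M := Series b).
  assert (HM0 : 0 <= M).
  { unfold M. rewrite <- (Rmult_0_l (Series b)), <- Series_scal_l.
    apply Series_le; trivial. intros n. rewrite Rmult_0_l. split; [lra|].
    unfold b. apply Rmult_le_pos; [apply Cmod_ge_0|apply pow_le; lra]. }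
  (* As r is the midpoint of |z| and 1, the distance 1 - r equals r - |z| and keeps w in the disc of
     radius r. *)
  intros eps Heps. exists (Rmin (1 - r) (eps / (M + 1))). split.
  { apply Rmin_pos; [lra|]. apply Rdiv_lt_0_compat; lra. }
  intros w Hwz. apply Rmin_Rgt_l in Hwz. destruct Hwz as [W1 W2].
  assert (Hzr : Cmod z <= r) by (unfold r; lra).
  assert (Hwr : Cmod w <= r).
  { replace w with (z + (w - z))%C by ring.
    eapply Rle_trans; [apply Cmod_triangle|]. unfold r in *. lra. }
  assert (Hw : Cmod w < 1) by lra.
  set (x := Cmod (w - z)) in *. assert (Hx : 0 <= x) by apply Cmod_ge_0.
  (* The terms of degree 0 and 1 have no remainder, so the series starts at degree 2. *)
  assert (Hs : is_CSeries (fun n => a (S (S n)) * (w ^ S (S n) - z ^ S (S n)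
      - (w - z) * (RtoC (INR (S (S n))) * z ^ S n)))%C
    (CPSeries a w - CPSeries a z - (w - z) * CPSeries (CPS_derive a) z)%C).
  { assert (H1 := is_CSeries_incr _ _ (is_CSeries_incr _ _ (CPSeries_correct _ _ Ha Hw))).
    assert (H2 := is_CSeries_incr _ _ (is_CSeries_incr _ _ (CPSeries_correct _ _ Ha Hz))).
    assert (H3 := is_CSeries_scal (w - z) _ _ (is_CSeries_incr _ _ (CPSeries_correct _ _ (CV_disc_derive _ Ha) Hz))).
    assert (H4 := is_CSeries_minus _ _ _ _ (is_CSeries_minus _ _ _ _ H1 H2) H3).
    cbv beta in H4.
    eapply is_CSeries_val; [|eapply is_CSeries_ext; [|exact H4]].
    - unfold CPS_derive. simpl. ring.
    - intros n. cbv beta. unfold CPS_derive. ring. }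
  apply Rle_trans with (M * x ^ 2).
  - replace (M * x ^ 2) with (Series (fun n => x ^ 2 * b n)).
    2:{ rewrite Series_scal_l. fold M. ring. }
    apply (Cmod_CSeries_le _ (fun n => x ^ 2 * b n)) with (3 := Hs).
    + intros n. rewrite Cmod_mult. unfold b, CPS_derive.
      rewrite !Cmod_mult, !Cmod_R, !Rabs_pos_eq by apply pos_INR.
      assert (H := pow_taylor2 w z r n Hwr Hzr). fold x in H.
      eapply Rle_trans; [apply Rmult_le_compat_l; [apply Cmod_ge_0|exact H]|].
      right. ring.
    + exact (@ex_series_scal_l R_AbsRing R_NormedModule (x ^ 2) b HM).
  - replace (M * x ^ 2) with ((M * x) * x) by ring. apply Rmult_le_compat_r; trivial.
    apply Rle_trans with (M * (eps / (M + 1))); [apply Rmult_le_compat_l; lra|].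
    apply Rle_trans with ((M + 1) * (eps / (M + 1))); [|right; field; lra].
    apply Rmult_le_compat_r; [|lra]. left. apply Rdiv_lt_0_compat; lra.
Qed.

Lemma CPSeries_split (a : nat -> C) (z : C) : CV_disc a -> Cmod z < 1 ->
  CPSeries a z = (a 0%nat + z * CPSeries (fun n => a (n + 1)%nat) z)%C.
Proof.
  intros Ha Hz. apply is_CSeries_unique.
  apply (is_CSeries_val _ ((a 0%nat * z ^ 0) + z * CPSeries (fun n => a (n + 1)%nat) z)%C).
  { simpl. ring. }
  apply (is_CSeries_decr (fun n => a n * z ^ n)%C).
  eapply is_CSeries_ext; [|apply is_CSeries_scal, CPSeries_correct; [|exact Hz]].
  - intros n. simpl. rewrite (Nat.add_1_r n). ring.
  - now apply CV_disc_shift.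
Qed.

Lemma CPSeries_0 (a : nat -> C) : CV_disc a -> CPSeries a (RtoC 0) = a 0%nat.
Proof. intros Ha. rewrite CPSeries_split; trivial; [ring|rewrite Cmod_0; lra]. Qed.

Lemma CPSeries_plus (a b : nat -> C) (z : C) : CV_disc a -> CV_disc b -> Cmod z < 1 ->
  CPSeries (fun n => a n + b n)%C z = (CPSeries a z + CPSeries b z)%C.
Proof.
  intros Ha Hb Hz. apply is_CSeries_unique.
  eapply is_CSeries_ext; [|apply is_CSeries_plus; apply CPSeries_correct; [exact Ha| |exact Hb|]; exact Hz].
  intros n. cring.
Qed.

Lemma CPSeries_scal (c : C) (a : nat -> C) (z : C) : CV_disc a -> Cmod z < 1 ->
  CPSeries (fun n => c * a n)%C z = (c * CPSeries a z)%C.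
Proof.
  intros Ha Hz. apply is_CSeries_unique.
  eapply is_CSeries_ext; [|apply is_CSeries_scal; apply CPSeries_correct; [exact Ha|exact Hz]].
  intros n. cring.
Qed.

Lemma CPSeries_ext (a b : nat -> C) (z : C) : (forall n, a n = b n) -> CPSeries a z = CPSeries b z.
Proof.
  intros H. unfold CPSeries, CSeries. f_equal; apply Series_ext; intros n; now rewrite H.
Qed.

Lemma CV_disc_index_mult (a : nat -> C) : CV_disc a -> CV_disc (fun n => RtoC (INR n) * a n)%C.
Proof. intros Ha. apply CV_disc_unshift. exact (CV_disc_derive a Ha). Qed.

Lemma CPSeries_index_mult (a : nat -> C) (z : C) : CV_disc a -> Cmod z < 1 ->
  CPSeries (fun n => RtoC (INR n) * a n)%C z = (z * CPSeries (CPS_derive a) z)%C.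
Proof.
  intros Ha Hz. rewrite CPSeries_split by (trivial; now apply CV_disc_index_mult).
  rewrite (CPSeries_ext _ (CPS_derive a)).
  - simpl. ring.
  - intros n. unfold CPS_derive. now rewrite Nat.add_1_r.
Qed.

(** * The minimum principle for the real part of a holomorphic function *)

(** Continuity of the derivative is what permits differentiating circle integrals under the integral
    sign. *)
Definition disc_der (g dg : C -> C) : Prop :=
  forall z : C, Cmod z < 1 -> Cder g z (dg z) /\ Ccont dg z.

Definition curve_der (c : R -> C) (t : R) (v : C) : Prop :=
  is_derive (fun s => Re (c s)) t (Re v) /\ is_derive (fun s => Im (c s)) t (Im v).

Lemma Cmod_le_Re_Im (z : C) : Cmod z <= Rabs (Re z) + Rabs (Im z).
Proof.
  replace z with (RtoC (Re z) + Ci * RtoC (Im z))%C at 1.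
  - eapply Rle_trans; [apply Cmod_triangle|].
    rewrite Cmod_mult, Cmod_Ci, !Cmod_R. lra.
  - destruct z as [x y]. unfold Re, Im, RtoC, Ci, Cplus, Cmult; simpl. f_equal; ring.
Qed.

Lemma Im_le_Cmod (z : C) : Rabs (Im z) <= Cmod z.
Proof. eapply Rle_trans; [apply Rmax_r|apply (Rmax_Cmod z)]. Qed.

Lemma is_derive_R_iff (f : R -> R) (t l : R) :
  is_derive f t l <->
  forall eps : R, 0 < eps -> exists d : R, 0 < d /\ forall s : R, Rabs (s - t) < d ->
    Rabs (f s - f t - (s - t) * l) <= eps * Rabs (s - t).
Proof.
  split.
  - intros [_ H] eps Heps.
    destruct (H t (fun P HP => HP) (mkposreal eps Heps)) as [d Hd].
    exists d. split; [apply cond_pos|]. intros s Hs. exact (Hd s Hs).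
  - intros H. split.
    + apply is_linear_scal_l.
    + intros x Hx.
      assert (x = t) as ->.
      { symmetry.
        exact (@is_filter_lim_locally_unique R_AbsRing (AbsRing_NormedModule R_AbsRing) t x Hx). }
      intros [eps Heps]. destruct (H eps Heps) as [d [Hd Hw]].
      exists (mkposreal d Hd). intros w Hb. exact (Hw w Hb).
Qed.

(** Components suit real integrals and the mean value theorem, while this form composes with
    [Cder]. *)
Lemma curve_der_iff (c : R -> C) (t : R) (v : C) :
  curve_der c t v <->
  forall eps : R, 0 < eps -> exists d : R, 0 < d /\ forall s : R, Rabs (s - t) < d ->
    Cmod (c s - c t - RtoC (s - t) * v) <= eps * Rabs (s - t).
Proof.
  assert (HR : forall s, Re (c s - c t - RtoC (s - t) * v) = Re (c s) - Re (c t) - (s - t) * Re v).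
  { intros s. unfold Cminus. rewrite !re_plus, !re_opp, re_scal_l. ring. }
  assert (HI : forall s, Im (c s - c t - RtoC (s - t) * v) = Im (c s) - Im (c t) - (s - t) * Im v).
  { intros s. unfold Cminus. rewrite !im_plus, !im_opp, im_scal_l. ring. }
  split.
  - intros [H1 H2] eps Heps.
    destruct (proj1 (is_derive_R_iff _ _ _) H1 (eps / 2) ltac:(lra)) as [d1 [Hd1 K1]].
    destruct (proj1 (is_derive_R_iff _ _ _) H2 (eps / 2) ltac:(lra)) as [d2 [Hd2 K2]].
    exists (Rmin d1 d2). split; [now apply Rmin_pos|]. intros s Hs.
    apply Rmin_Rgt_l in Hs. destruct Hs as [S1 S2].
    specialize (K1 s S1). specialize (K2 s S2).
    eapply Rle_trans; [apply Cmod_le_Re_Im|]. rewrite HR, HI. lra.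
  - intros H. split; apply is_derive_R_iff; intros eps Heps;
      destruct (H eps Heps) as [d [Hd K]]; exists d; (split; [exact Hd|]); intros s Hs;
      (eapply Rle_trans; [|apply (K s Hs)]).
    + rewrite <- HR. apply re_le_Cmod.
    + rewrite <- HI. apply Im_le_Cmod.
Qed.

Lemma curve_der_comp (g : C -> C) (c : R -> C) (t : R) (l v : C) :
  Cder g (c t) l -> curve_der c t v -> curve_der (fun s => g (c s)) t (l * v)%C.
Proof.
  intros Hg Hc. apply curve_der_iff. intros eps Heps.
  set (M := Cmod v + 1). assert (HM : 0 < M) by (generalize (Cmod_ge_0 v); unfold M; lra).
  set (N := Cmod l + 1). assert (HN : 0 < N) by (generalize (Cmod_ge_0 l); unfold N; lra).
  rewrite curve_der_iff in Hc.
  destruct (Hc 1 Rlt_0_1) as [d1 [Hd1 H1]].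
  destruct (Hc (eps / 2 / N)) as [d2 [Hd2 H2]].
  { repeat apply Rdiv_lt_0_compat; lra. }
  destruct (Hg (eps / 2 / M)) as [d3 [Hd3 H3]].
  { repeat apply Rdiv_lt_0_compat; lra. }
  exists (Rmin (Rmin d1 d2) (d3 / M)). split.
  { repeat apply Rmin_pos; trivial. now apply Rdiv_lt_0_compat. }
  intros s Hs. apply Rmin_Rgt_l in Hs. destruct Hs as [S12 S3].
  apply Rmin_Rgt_l in S12. destruct S12 as [S1 S2].
  specialize (H1 s S1). specialize (H2 s S2).
  assert (H4 : Cmod (c s - c t) <= M * Rabs (s - t)).
  { replace (c s - c t)%C with ((c s - c t - RtoC (s - t) * v) + RtoC (s - t) * v)%C by ring.
    eapply Rle_trans; [apply Cmod_triangle|]. rewrite Cmod_mult, Cmod_R. unfold M. lra. }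
  assert (W4 : Cmod (c s - c t) < d3).
  { eapply Rle_lt_trans; [exact H4|].
    replace d3 with (M * (d3 / M)) by (field; lra). now apply Rmult_lt_compat_l. }
  specialize (H3 _ W4).
  replace (g (c s) - g (c t) - RtoC (s - t) * (l * v))%C with
    ((g (c s) - g (c t) - (c s - c t) * l) + (c s - c t - RtoC (s - t) * v) * l)%C by ring.
  eapply Rle_trans; [apply Cmod_triangle|]. rewrite Cmod_mult.
  replace (eps * Rabs (s - t)) with
    (eps / 2 / M * (M * Rabs (s - t)) + eps / 2 / N * Rabs (s - t) * N) by (field; lra).
  apply Rplus_le_compat.
  - eapply Rle_trans; [exact H3|]. apply Rmult_le_compat_l; trivial.
    left. repeat apply Rdiv_lt_0_compat; lra.
  - apply Rmult_le_compat; try apply Cmod_ge_0; trivial. unfold N; lra.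
Qed.

Definition cis (t : R) : C := (cos t, sin t).

Lemma Cmod_cis (t : R) : Cmod (cis t) = 1.
Proof.
  unfold Cmod, cis; simpl. rewrite !Rmult_1_r.
  generalize (sin2_cos2 t). unfold Rsqr. intros H.
  replace (cos t * cos t + sin t * sin t) with 1 by lra. apply sqrt_1.
Qed.

Lemma Cmod_circle (r t : R) : Cmod (RtoC r * cis t) = Rabs r.
Proof. now rewrite Cmod_mult, Cmod_R, Cmod_cis, Rmult_1_r. Qed.

Lemma curve_der_radius (r t : R) : curve_der (fun s => RtoC s * cis t)%C r (cis t).
Proof.
  split.
  - eapply is_derive_ext; [intros s; symmetry; apply re_scal_l|].
    unfold cis, Re; simpl. auto_derive; trivial. ring.
  - eapply is_derive_ext; [intros s; symmetry; apply im_scal_l|].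
    unfold cis, Im; simpl. auto_derive; trivial. ring.
Qed.

Lemma curve_der_angle (r t : R) :
  curve_der (fun s => RtoC r * cis s)%C t (RtoC r * (Ci * cis t))%C.
Proof.
  split.
  - rewrite re_scal_l. eapply is_derive_ext; [intros s; symmetry; apply re_scal_l|].
    unfold cis, Re; simpl. auto_derive; trivial. ring.
  - rewrite im_scal_l. eapply is_derive_ext; [intros s; symmetry; apply im_scal_l|].
    unfold cis, Im; simpl. auto_derive; trivial. ring.
Qed.

(** Joint continuity in radius and angle is the form that [is_derive_RInt_param] asks for. *)
Lemma continuity_2d_polar (h : C -> C) (r t : R) : Ccont h (RtoC r * cis t)%C ->
  continuity_2d_pt (fun u v => Re (h (RtoC u * cis v)%C)) r t /\
  continuity_2d_pt (fun u v => Im (h (RtoC u * cis v)%C)) r t.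
Proof.
  intros H.
  assert (Hc : continuity_2d_pt (fun u v => u * cos v) r t).
  { apply continuity_2d_pt_mult; [apply continuity_2d_pt_id1|].
    apply continuity_1d_2d_pt_comp; [apply continuity_cos|apply continuity_2d_pt_id2]. }
  assert (Hs : continuity_2d_pt (fun u v => u * sin v) r t).
  { apply continuity_2d_pt_mult; [apply continuity_2d_pt_id1|].
    apply continuity_1d_2d_pt_comp; [apply continuity_sin|apply continuity_2d_pt_id2]. }
  assert (K : forall eps : posreal, exists d : posreal, forall u v, Rabs (u - r) < d ->
    Rabs (v - t) < d -> Cmod (h (RtoC u * cis v) - h (RtoC r * cis t))%C < eps).
  { intros eps. destruct (H eps (cond_pos eps)) as [e [He He']].
    destruct (Hc (pos_div_2 (mkposreal e He))) as [d1 H1].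
    destruct (Hs (pos_div_2 (mkposreal e He))) as [d2 H2].
    assert (Hd : 0 < Rmin d1 d2) by (apply Rmin_pos; apply cond_pos).
    exists (mkposreal _ Hd). simpl. intros u v Hu Hv.
    apply Rmin_Rgt_l in Hu, Hv.
    apply He'. eapply Rle_lt_trans; [apply Cmod_le_Re_Im|].
    specialize (H1 u v (proj1 Hu) (proj1 Hv)). specialize (H2 u v (proj2 Hu) (proj2 Hv)).
    unfold Cminus. rewrite re_plus, im_plus, re_opp, im_opp, !re_scal_l, !im_scal_l.
    unfold cis, Re, Im. simpl in *. unfold Rminus in *. lra. }
  split; intros eps; destruct (K eps) as [d Hd]; exists d; intros u v Hu Hv;
    (eapply Rle_lt_trans; [|apply (Hd u v Hu Hv)]).
  - replace (_ - _) with (Re (h (RtoC u * cis v) - h (RtoC r * cis t))%C).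
    + apply re_le_Cmod.
    + unfold Cminus. now rewrite re_plus, re_opp.
  - replace (_ - _) with (Im (h (RtoC u * cis v) - h (RtoC r * cis t))%C).
    + apply Im_le_Cmod.
    + unfold Cminus. now rewrite im_plus, im_opp.
Qed.

Lemma continuity_2d_polar_deriv (h : C -> C) (r t : R) : Ccont h (RtoC r * cis t)%C ->
  continuity_2d_pt (fun u v => Re (h (RtoC u * cis v) * cis v)%C) r t.
Proof.
  intros H. destruct (continuity_2d_polar h r t H) as [H1 H2].
  apply continuity_2d_pt_ext with
    (fun u v => Re (h (RtoC u * cis v)%C) * cos v - Im (h (RtoC u * cis v)%C) * sin v).
  { intros u v. now rewrite re_mult. }
  apply continuity_2d_pt_minus; apply continuity_2d_pt_mult; trivial;
    apply continuity_1d_2d_pt_comp; try apply continuity_2d_pt_id2.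
  - apply continuity_cos.
  - apply continuity_sin.
Qed.

Lemma continuous_of_2d (f : R -> R -> R) (r t : R) :
  continuity_2d_pt f r t -> continuous (fun v => f r v) t.
Proof.
  intros H. apply filterlim_locally. intros eps. destruct (H eps) as [d Hd].
  exists d. intros v Hv. apply Hd; [|exact Hv].
  rewrite Rminus_diag, Rabs_R0. apply cond_pos.
Qed.

Lemma disc_der_cont (g dg : C -> C) (z : C) : disc_der g dg -> Cmod z < 1 -> Ccont g z.
Proof. intros H Hz. eapply Cder_cont. apply (H z Hz). Qed.

(* [Re (g' (r e^{it}) e^{it})] is the [t]-derivative of [Im g (r e^{it}) / r],
   which is periodic; at [r = 0] the same argument runs on [g' (0) z]. *)
Lemma RInt_radial_deriv (g dg : C -> C) (r : R) : disc_der g dg -> Rabs r < 1 ->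
  RInt (fun t => Re (dg (RtoC r * cis t) * cis t)%C) 0 (2 * PI) = 0.
Proof.
  intros H Hr.
  assert (Hz : forall t, Cmod (RtoC r * cis t) < 1) by (intros t; now rewrite Cmod_circle).
  assert (Hp : cis (2 * PI) = cis 0).
  { unfold cis. now rewrite cos_2PI, sin_2PI, cos_0, sin_0. }
  assert (Hcont : forall t, continuous (fun t => Re (dg (RtoC r * cis t) * cis t)%C) t).
  { intros t. apply (continuous_of_2d (fun u v => Re (dg (RtoC u * cis v) * cis v)%C)).
    apply continuity_2d_polar_deriv. apply (H _ (Hz t)). }
  apply is_RInt_unique.
  destruct (Req_dec r 0) as [->|Hr0].
  - set (d0 := dg (RtoC 0)).
    apply is_RInt_ext with (fun t => Re (d0 * cis t)%C).
    { intros t _. do 2 f_equal. unfold d0. f_equal. ring. }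
    replace 0 with (Re (- Ci * d0 * (RtoC 1 * cis (2 * PI)))%C
      - Re (- Ci * d0 * (RtoC 1 * cis 0))%C) at 2 by (rewrite Hp; ring).
    apply (is_RInt_derive (fun t => Re (- Ci * d0 * (RtoC 1 * cis t))%C)).
    + intros t _.
      replace (d0 * cis t)%C with (- Ci * d0 * (RtoC 1 * (Ci * cis t)))%C.
      2:{ replace (- Ci * d0 * (1 * (Ci * cis t)))%C with (- (Ci * Ci) * (d0 * cis t))%C by ring.
          replace (Ci * Ci)%C with (- (1))%C; [ring|].
          unfold Ci, Cmult, RtoC, Copp; simpl. f_equal; ring. }
      apply (curve_der_comp (fun z => - Ci * d0 * z)%C (fun s => RtoC 1 * cis s)%C).
      * eapply Cder_eq; [apply Cder_scal, Cder_id|cring].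
      * apply curve_der_angle.
    + intros t _. specialize (Hcont t). eapply continuous_ext; [|exact Hcont].
      intros s. cbv beta. do 2 f_equal. unfold d0. f_equal. ring.
  - apply is_RInt_ext with (fun t => scal (/ r) (Re (- Ci * dg (RtoC r * cis t) * (RtoC r * (Ci * cis t)))%C)).
    { intros t _. replace (- Ci * dg (RtoC r * cis t) * (RtoC r * (Ci * cis t)))%C
        with (RtoC r * (- (Ci * Ci) * (dg (RtoC r * cis t) * cis t)))%C by ring.
      rewrite re_scal_l.
      replace (Ci * Ci)%C with (- (1))%C.
      2:{ unfold Ci, Cmult, RtoC, Copp; simpl. f_equal; ring. }
      replace (- - (1) * (dg (RtoC r * cis t) * cis t))%C with (dg (RtoC r * cis t) * cis t)%C by ring.
      unfold scal; simpl; unfold mult; simpl. field. exact Hr0. }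
    (* [Re (- Ci * g)] is the imaginary part of g; its increment over a full turn is 0 by [Hp]. *)
    replace 0 with (scal (/ r) (minus (Re (- Ci * g (RtoC r * cis (2 * PI)))%C)
      (Re (- Ci * g (RtoC r * cis 0))%C))) at 2.
    2:{ rewrite Hp, minus_eq_zero. apply (@scal_zero_r R_Ring R_ModuleSpace). }
    apply (@is_RInt_scal R_NormedModule).
    apply (is_RInt_derive (fun t => Re (- Ci * g (RtoC r * cis t))%C)).
    + intros t _.
      apply (curve_der_comp (fun z => - Ci * g z)%C (fun s => RtoC r * cis s)%C).
      * apply Cder_scal. apply (H _ (Hz t)).
      * apply curve_der_angle.
    + intros t _.
      apply continuous_ext with (fun t => scal r (Re (dg (RtoC r * cis t) * cis t)%C)).
      2:{ apply (continuous_scal_r r (fun t => Re (dg (RtoC r * cis t) * cis t)%C)), Hcont. }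
      clear t. intros t. cbv beta.
      replace (- Ci * dg (RtoC r * cis t) * (RtoC r * (Ci * cis t)))%C
        with (RtoC r * (- (Ci * Ci) * (dg (RtoC r * cis t) * cis t)))%C by ring.
      rewrite re_scal_l.
      replace (Ci * Ci)%C with (- (1))%C.
      2:{ unfold Ci, Cmult, RtoC, Copp; simpl. f_equal; ring. }
      replace (- - (1) * (dg (RtoC r * cis t) * cis t))%C with (dg (RtoC r * cis t) * cis t)%C by ring.
      reflexivity.
Qed.

Lemma ex_RInt_circle (g dg : C -> C) (r : R) : disc_der g dg -> Rabs r < 1 ->
  ex_RInt (fun t => Re (g (RtoC r * cis t)%C)) 0 (2 * PI).
Proof.
  intros H Hr. apply (@ex_RInt_continuous R_CompleteNormedModule). intros t _.
  apply (continuous_of_2d (fun u v => Re (g (RtoC u * cis v)%C))).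
  apply continuity_2d_polar. eapply disc_der_cont; [exact H|]. now rewrite Cmod_circle.
Qed.

(** The derivative of the circle integral with respect to the radius is the integral of
    [RInt_radial_deriv], which is 0. The circle integral is therefore constant, and radius 0 gives
    its value. *)
Lemma mean_value_Re (g dg : C -> C) (r : R) : disc_der g dg -> 0 <= r < 1 ->
  RInt (fun t => Re (g (RtoC r * cis t)%C)) 0 (2 * PI) = 2 * PI * Re (g (RtoC 0)).
Proof.
  intros H Hr.
  set (m := fun s => RInt (fun t => Re (g (RtoC s * cis t)%C)) 0 (2 * PI)).
  assert (Hm0 : m 0 = 2 * PI * Re (g (RtoC 0))).
  { unfold m. rewrite (RInt_ext _ (fun _ => Re (g (RtoC 0)))).
    - rewrite RInt_const. unfold scal; simpl; unfold mult; simpl. ring.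
    - intros t _. do 2 f_equal. ring. }
  assert (Hpart : forall s t, Rabs s < 1 ->
    is_derive (fun u => Re (g (RtoC u * cis t)%C)) s (Re (dg (RtoC s * cis t) * cis t)%C)).
  { intros s t Hs. apply (curve_der_comp g (fun u => RtoC u * cis t)%C).
    - apply H. now rewrite Cmod_circle.
    - apply curve_der_radius. }
  assert (Hloc : forall s, Rabs s < 1 -> exists d : posreal, forall u, Rabs (u - s) < d -> Rabs u < 1).
  { intros s Hs. assert (Hd : 0 < 1 - Rabs s) by lra. exists (mkposreal _ Hd). simpl.
    intros u Hu. replace u with (s + (u - s)) by ring.
    eapply Rle_lt_trans; [apply Rabs_triang|]. lra. }
  assert (Hder : forall s, Rabs s < 1 -> is_derive m s 0).
  { intros s Hs. destruct (Hloc s Hs) as [d Hd].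
    rewrite <- (RInt_radial_deriv g dg s H Hs).
    rewrite (RInt_ext _ (fun t => Derive (fun u => Re (g (RtoC u * cis t)%C)) s)).
    2:{ intros t _. symmetry. apply is_derive_unique. now apply Hpart. }
    apply is_derive_RInt_param.
    - exists d. intros u Hu t _. eexists. apply Hpart. now apply Hd.
    - intros t _.
      apply continuity_2d_pt_ext_loc with (fun u v => Re (dg (RtoC u * cis v) * cis v)%C).
      + exists d. intros u v Hu _. symmetry. apply is_derive_unique. apply Hpart. now apply Hd.
      + apply continuity_2d_polar_deriv. apply H. now rewrite Cmod_circle.
    - exists d. intros u Hu. apply (ex_RInt_circle g dg); trivial. now apply Hd. }
  rewrite <- Hm0. change (m r = m 0).
  destruct (MVT_gen m 0 r (fun _ => 0)) as [c [_ Hc]].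
  - intros x Hx. apply Hder. rewrite Rmin_left, Rmax_right in Hx by lra.
    rewrite Rabs_pos_eq; lra.
  - intros x Hx. rewrite Rmin_left, Rmax_right in Hx by lra.
    apply derivable_continuous_pt. exists 0. apply is_derive_Reals. apply Hder.
    rewrite Rabs_pos_eq; lra.
  - lra.
Qed.

Lemma min_principle_Re (g dg : C -> C) (r m : R) : disc_der g dg -> 0 <= r < 1 ->
  (forall z, Cmod z = r -> m <= Re (g z)) -> m <= Re (g (RtoC 0)).
Proof.
  intros H Hr Hm. assert (Hpi := PI_RGT_0).
  assert (Hrr : Rabs r < 1) by (rewrite Rabs_pos_eq; lra).
  apply Rmult_le_reg_l with (2 * PI); [lra|].
  rewrite <- (mean_value_Re g dg r H Hr).
  replace (2 * PI * m) with (RInt (fun _ => m) 0 (2 * PI)).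
  2:{ rewrite RInt_const. unfold scal; simpl; unfold mult; simpl. ring. }
  apply RInt_le; [lra|apply ex_RInt_const|now apply (ex_RInt_circle g dg)|].
  intros t _. apply Hm. rewrite Cmod_circle, Rabs_pos_eq; lra.
Qed.

(** * Clunie's inequality *)

Lemma Ccont_const (c z : C) : Ccont (fun _ => c) z.
Proof. eapply Cder_cont, Cder_const. Qed.

Lemma Ccont_plus (f g : C -> C) (z : C) :
  Ccont f z -> Ccont g z -> Ccont (fun w => f w + g w)%C z.
Proof.
  intros Hf Hg eps Heps.
  destruct (Hf (eps / 2) ltac:(lra)) as [d1 [Hd1 H1]].
  destruct (Hg (eps / 2) ltac:(lra)) as [d2 [Hd2 H2]].
  exists (Rmin d1 d2). split; [now apply Rmin_pos|]. intros w Hw.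
  apply Rmin_Rgt_l in Hw. destruct Hw as [W1 W2].
  specialize (H1 w W1). specialize (H2 w W2).
  replace (f w + g w - (f z + g z))%C with ((f w - f z) + (g w - g z))%C by ring.
  eapply Rle_lt_trans; [apply Cmod_triangle|]. lra.
Qed.

Lemma Ccont_mult (f g : C -> C) (z : C) :
  Ccont f z -> Ccont g z -> Ccont (fun w => f w * g w)%C z.
Proof.
  intros Hf Hg eps Heps.
  set (M := Cmod (f z) + 1). assert (HM : 1 <= M) by (generalize (Cmod_ge_0 (f z)); unfold M; lra).
  set (N := Cmod (g z) + 1). assert (HN : 1 <= N) by (generalize (Cmod_ge_0 (g z)); unfold N; lra).
  destruct (Hf (Rmin 1 (eps / 2 / N))) as [d1 [Hd1 H1]].
  { apply Rmin_pos; [lra|]. repeat apply Rdiv_lt_0_compat; lra. }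
  destruct (Hg (eps / 2 / M)) as [d2 [Hd2 H2]].
  { repeat apply Rdiv_lt_0_compat; lra. }
  exists (Rmin d1 d2). split; [now apply Rmin_pos|]. intros w Hw.
  apply Rmin_Rgt_l in Hw. destruct Hw as [W1 W2].
  specialize (H1 w W1). specialize (H2 w W2).
  apply Rmin_Rgt_l in H1. destruct H1 as [H1 H1'].
  replace (f w * g w - f z * g z)%C with ((f w - f z) * g z + f w * (g w - g z))%C by ring.
  assert (Hfw : Cmod (f w) <= M).
  { replace (f w) with (f z + (f w - f z))%C by ring.
    eapply Rle_trans; [apply Cmod_triangle|]. unfold M. lra. }
  eapply Rle_lt_trans; [apply Cmod_triangle|]. rewrite !Cmod_mult.
  replace eps with (eps / 2 / N * N + M * (eps / 2 / M)) by (field; lra).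
  apply Rplus_lt_le_compat.
  - assert (Hgz := Cmod_ge_0 (g z)). assert (H0 := Cmod_ge_0 (f w - f z)).
    assert (Cmod (g z) < N) by (unfold N; lra). nra.
  - apply Rmult_le_compat; try apply Cmod_ge_0; lra.
Qed.

Lemma Ccont_comp (f g : C -> C) (z : C) :
  Ccont f (g z) -> Ccont g z -> Ccont (fun w => f (g w)) z.
Proof.
  intros Hf Hg eps Heps. destruct (Hf eps Heps) as [d [Hd H]].
  destruct (Hg d Hd) as [e [He K]]. exists e. split; trivial. intros w Hw. auto.
Qed.

Lemma Ccont_inv (f : C -> C) (z : C) : f z <> RtoC 0 -> Ccont f z -> Ccont (fun w => / f w)%C z.
Proof.
  intros Hz Hf. apply (Ccont_comp Cinv f); trivial. eapply Cder_cont, Cder_inv_id, Hz.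
Qed.

(** Its closure under arithmetic reduces the regularity of the functions in Clunie's argument to
    that of power series. *)
Definition disc_C1 (f : C -> C) : Prop := exists df, disc_der f df.

Lemma disc_C1_const (c : C) : disc_C1 (fun _ => c).
Proof.
  exists (fun _ => RtoC 0). intros z _. split; [apply Cder_const|apply Ccont_const].
Qed.

Lemma disc_C1_id : disc_C1 (fun z => z).
Proof.
  exists (fun _ => RtoC 1). intros z _. split; [apply Cder_id|apply Ccont_const].
Qed.

Lemma disc_C1_plus (f g : C -> C) :
  disc_C1 f -> disc_C1 g -> disc_C1 (fun z => f z + g z)%C.
Proof.
  intros [df Hf] [dg Hg]. exists (fun z => df z + dg z)%C. intros z Hz.
  destruct (Hf z Hz), (Hg z Hz). split; [now apply Cder_plus|now apply Ccont_plus].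
Qed.

Lemma disc_C1_mult (f g : C -> C) :
  disc_C1 f -> disc_C1 g -> disc_C1 (fun z => f z * g z)%C.
Proof.
  intros [df Hf] [dg Hg]. exists (fun z => df z * g z + f z * dg z)%C. intros z Hz.
  assert (Hf0 := disc_der_cont _ _ _ Hf Hz). assert (Hg0 := disc_der_cont _ _ _ Hg Hz).
  destruct (Hf z Hz), (Hg z Hz). split; [now apply Cder_mult|].
  apply Ccont_plus; now apply Ccont_mult.
Qed.

Lemma disc_C1_ext (f g : C -> C) :
  (forall z, Cmod z < 1 -> f z = g z) -> disc_C1 f -> disc_C1 g.
Proof.
  intros H [df Hf]. exists df. intros z Hz. destruct (Hf z Hz) as [H1 H2]. split; trivial.
  apply (Cder_ext_loc f g z _ (1 - Cmod z)); trivial; [lra|].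
  intros w Hw. apply H. replace w with (z + (w - z))%C by ring.
  eapply Rle_lt_trans; [apply Cmod_triangle|]. lra.
Qed.

Lemma disc_C1_minus (f g : C -> C) :
  disc_C1 f -> disc_C1 g -> disc_C1 (fun z => f z - g z)%C.
Proof.
  intros Hf Hg. apply (disc_C1_ext (fun z => f z + (RtoC (-1)) * g z)%C).
  - intros z _. replace (RtoC (-1)) with (- (1))%C; [ring|].
    rewrite <- RtoC_opp. reflexivity.
  - apply disc_C1_plus; trivial. apply disc_C1_mult; trivial. apply disc_C1_const.
Qed.

Lemma disc_C1_div (f g : C -> C) : (forall z, Cmod z < 1 -> g z <> RtoC 0) ->
  disc_C1 f -> disc_C1 g -> disc_C1 (fun z => f z / g z)%C.
Proof.
  intros H0 Hf [dg Hg]. apply disc_C1_mult; trivial.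
  exists (fun z => - (1) * / (g z * g z) * dg z)%C. intros z Hz.
  assert (Hg0 := disc_der_cont _ _ _ Hg Hz). assert (Hz0 := H0 z Hz).
  destruct (Hg z Hz). split.
  - eapply Cder_eq; [apply Cder_inv; eassumption|ring].
  - apply Ccont_mult; trivial. apply Ccont_mult; [apply Ccont_const|].
    apply (Ccont_inv (fun z => g z * g z)%C); [now apply Cmult_neq_0|now apply Ccont_mult].
Qed.

Lemma disc_C1_CPSeries (a : nat -> C) : CV_disc a -> disc_C1 (CPSeries a).
Proof.
  intros Ha. exists (CPSeries (CPS_derive a)). intros z Hz. split; [now apply CPSeries_der|].
  eapply Cder_cont. apply CPSeries_der; trivial. now apply CV_disc_derive.
Qed.

Lemma disc_C1_hol (f : C -> C) : disc_C1 f -> holomorphic_on_disc f.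
Proof.
  intros [df H] z Hz. exists (df z). apply is_derive_Cder. now apply H.
Qed.

(** * Squared moduli of polynomials on a circle *)

Fixpoint poly (a : nat -> C) (m : nat) (z : C) : C :=
  match m with O => RtoC 0 | S k => poly a k z + a k * z ^ k end.

(* On [|z| = r], where [conj z = r^2 / z], this polynomial is
   [conj (poly a m z) * z ^ m]. *)
Fixpoint mirror (r : R) (a : nat -> C) (m : nat) (z : C) : C :=
  match m with
  | O => RtoC 0
  | S k => z * (mirror r a k z + Cconj (a k) * RtoC (r ^ (2 * k)))
  end.

(** By Parseval, the mean of |[poly a m]|^2 over the circle of radius r. *)
Fixpoint square_sum (r : R) (a : nat -> C) (m : nat) : R :=
  match m with O => 0 | S k => square_sum r a k + Cmod (a k) ^ 2 * r ^ (2 * k) end.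

(** A polynomial in z vanishing at 0; on |z| = r, twice its real part is the off-diagonal part of
    |[poly a m z]|^2. *)
Fixpoint cross_terms (r : R) (a : nat -> C) (m : nat) (z : C) : C :=
  match m with O => RtoC 0 | S k => cross_terms r a k z + mirror r a k z * a k end.

Lemma CPSeries_poly (a : nat -> C) (m : nat) (z : C) : CV_disc a -> Cmod z < 1 ->
  CPSeries a z = (poly a m z + z ^ m * CPSeries (fun n => a (n + m)%nat) z)%C.
Proof.
  intros Ha Hz. induction m as [|m IH].
  - simpl. rewrite (CPSeries_ext (fun n => a (n + 0)%nat) a).
    + ring.
    + intros n. now rewrite Nat.add_0_r.
  - rewrite IH. rewrite (CPSeries_split (fun n => a (n + m)%nat)); trivial.
    2:{ now apply CV_disc_shift. }
    rewrite (CPSeries_ext (fun n => a (n + S m)%nat) (fun n => a (n + 1 + m)%nat)).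
    2:{ intros n. f_equal. lia. }
    simpl. ring.
Qed.

Lemma Cmod2_plus (u v : C) :
  Cmod (u + v) ^ 2 = Cmod u ^ 2 + Cmod v ^ 2 + 2 * Re (Cconj u * v).
Proof.
  rewrite !Cmod2_alt, re_plus, im_plus, re_mult, re_conj, im_conj. ring.
Qed.

Lemma Cconj_pow_mul (z : C) (k : nat) :
  (Cconj z ^ k * z ^ k)%C = RtoC (Cmod z ^ (2 * k)).
Proof.
  rewrite <- Cpow_mult_l, (Cmult_comm (Cconj z)), <- Cmod2_conj, <- RtoC_pow, <- pow_mult.
  reflexivity.
Qed.

Lemma mirror_eq (a : nat -> C) (m : nat) (z : C) :
  (Cconj (poly a m z) * z ^ m)%C = mirror (Cmod z) a m z.
Proof.
  induction m as [|m IH]; [simpl; unfold Cconj, RtoC, Cmult; simpl; f_equal; ring|].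
  cbn [poly mirror]. rewrite <- IH, <- Cconj_pow_mul, Cplus_conj, Cmult_conj, Cpow_conj.
  rewrite Cpow_S. ring.
Qed.

(** This replaces Parseval's identity: the non-constant part is the trace of a holomorphic function
    vanishing at 0, so it can be absorbed into the function given to the minimum principle. *)
Lemma poly_square (a : nat -> C) (m : nat) (z : C) :
  Cmod (poly a m z) ^ 2 =
  square_sum (Cmod z) a m + 2 * Re (cross_terms (Cmod z) a m z).
Proof.
  induction m as [|m IH]; [simpl; rewrite Cmod_0; ring|].
  cbn [poly square_sum cross_terms].
  rewrite Cmod2_plus, IH, re_plus, <- mirror_eq, Cmod_mult, Cmod_pow.
  rewrite Rpow_mult_distr, <- pow_mult, (Nat.mul_comm m 2).
  replace (Cconj (poly a m z) * (a m * z ^ m))%C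
    with (Cconj (poly a m z) * z ^ m * a m)%C by ring.
  ring.
Qed.

Lemma disc_C1_mirror (r : R) (a : nat -> C) (m : nat) : disc_C1 (mirror r a m).
Proof.
  induction m as [|m IH]; [apply disc_C1_const|].
  apply (disc_C1_mult (fun z => z)); [apply disc_C1_id|].
  apply disc_C1_plus; [exact IH|apply disc_C1_const].
Qed.

Lemma disc_C1_cross_terms (r : R) (a : nat -> C) (m : nat) : disc_C1 (cross_terms r a m).
Proof.
  induction m as [|m IH]; [apply disc_C1_const|].
  apply disc_C1_plus; [exact IH|]. apply disc_C1_mult; [apply disc_C1_mirror|].
  apply disc_C1_const.
Qed.

Lemma mirror_0 (r : R) (a : nat -> C) (m : nat) : mirror r a m (RtoC 0) = RtoC 0.
Proof. destruct m; simpl; ring. Qed.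

Lemma cross_terms_0 (r : R) (a : nat -> C) (m : nat) : cross_terms r a m (RtoC 0) = RtoC 0.
Proof.
  induction m as [|m IH]; simpl; trivial. rewrite IH, mirror_0. ring.
Qed.

(* Clunie: [phi * poly u m = poly t (m + 1) + z ^ m * psi] with [psi 0 = 0], and on
   the circle [conj (poly t (m + 1)) * z ^ m * psi] is the trace of a
   holomorphic function vanishing at 0. *)
Lemma clunie_radius (phi : C -> C) (t u : nat -> C) (r : R) (m : nat) :
  disc_C1 phi -> phi (RtoC 0) = RtoC 0 -> (forall z, Cmod z < 1 -> Cmod (phi z) <= 1) ->
  CV_disc t -> CV_disc u -> (forall z, Cmod z < 1 -> (phi z * CPSeries u z)%C = CPSeries t z) ->
  0 <= r < 1 -> square_sum r t (S m) <= square_sum r u m.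
Proof.
  intros Hphi H0 Hb Ht Hu He Hr.
  (* The tail of t starts one degree later than that of u. The extra factor z accounts for this, and
     with phi 0 = 0 it gives psi 0 = 0. *)
  set (psi := fun z => (z * CPSeries (fun n => t (n + S m)%nat) z
    - phi z * CPSeries (fun n => u (n + m)%nat) z)%C).
  (* The first factor is [mirror r t (S m) z] without its outer factor z: [poly t (S m)] has degree
     at most m, so z^m suffices to clear its conjugate. *)
  set (K := fun z => ((mirror r t m z + Cconj (t m) * RtoC (r ^ (2 * m))) * psi z)%C).
  (* With U = [poly u m z], on |z| = r the real part of g is |U|^2 - |phi U|^2 + |z^m psi|^2 plus
     the difference of the square sums of t and u. The first three terms together are nonnegative,
     and g vanishes at 0. *)
  set (g := fun z => (RtoC 2 * (cross_terms r u m z - cross_terms r t (S m) z - K z))%C).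
  assert (Hpsi : disc_C1 psi).
  { apply disc_C1_minus; apply disc_C1_mult; trivial;
      [apply disc_C1_id|apply disc_C1_CPSeries|apply disc_C1_CPSeries]; now apply CV_disc_shift. }
  assert (Hg : disc_C1 g).
  { apply disc_C1_mult; [apply disc_C1_const|]. apply disc_C1_minus.
    - apply disc_C1_minus; apply disc_C1_cross_terms.
    - apply disc_C1_mult; trivial.
      apply disc_C1_plus; [apply disc_C1_mirror|apply disc_C1_const]. }
  assert (Hg0 : g (RtoC 0) = RtoC 0).
  { unfold g, K, psi. rewrite !cross_terms_0, H0. ring. }
  assert (Hmin : square_sum r t (S m) - square_sum r u m <= Re (g (RtoC 0))).
  { destruct Hg as [dg Hg]. apply (min_principle_Re g dg r); trivial.
    intros z Hz. assert (Hz1 : Cmod z < 1) by lra.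
    assert (Hsplit : (phi z * poly u m z)%C = (poly t (S m) z + z ^ m * psi z)%C).
    { assert (E := He z Hz1). rewrite (CPSeries_poly u m), (CPSeries_poly t (S m)) in E; trivial.
      unfold psi. transitivity (phi z * (poly u m z
        + z ^ m * CPSeries (fun n => u (n + m)%nat) z)
        - z ^ m * (phi z * CPSeries (fun n => u (n + m)%nat) z))%C; [ring|].
      rewrite E, Cpow_S. ring. }
    assert (HK : (Cconj (poly t (S m) z) * (z ^ m * psi z))%C = K z).
    { unfold K. rewrite <- Hz, <- mirror_eq, <- Cconj_pow_mul. cbn [poly].
      rewrite Cplus_conj, Cmult_conj, Cpow_conj. ring. }
    assert (E1 := Cmod2_plus (poly t (S m) z) (z ^ m * psi z)).
    rewrite HK, <- Hsplit, poly_square, Hz in E1.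
    assert (E2 := poly_square u m z). rewrite Hz in E2.
    assert (E3 : Cmod (phi z * poly u m z) ^ 2 <= Cmod (poly u m z) ^ 2).
    { rewrite Cmod_mult. apply pow_incr.
      assert (P1 := Cmod_ge_0 (phi z)). assert (P2 := Cmod_ge_0 (poly u m z)).
      assert (P3 := Hb z Hz1). nra. }
    assert (E4 := pow2_ge_0 (Cmod (z ^ m * psi z))).
    unfold g. rewrite re_scal_l. unfold Cminus. rewrite !re_plus, !re_opp. lra. }
  rewrite Hg0 in Hmin. unfold Re, RtoC in Hmin; simpl fst in Hmin. lra.
Qed.

Lemma square_sum_cont (a : nat -> C) (m : nat) :
  continuity_pt (fun r => square_sum r a m) 1.
Proof.
  induction m as [|m IH].
  - apply continuity_pt_const. intros x y. reflexivity.
  - apply continuity_pt_plus; [exact IH|]. apply continuity_pt_mult.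
    + apply continuity_pt_const. intros x y. reflexivity.
    + apply derivable_continuous_pt, derivable_pt_pow.
Qed.

(** Both sides are polynomials in the radius, so a strict violation at radius 1 would persist at
    some radius just below 1, against [clunie_radius]. *)
Lemma clunie (phi : C -> C) (t u : nat -> C) (m : nat) :
  disc_C1 phi -> phi (RtoC 0) = RtoC 0 -> (forall z, Cmod z < 1 -> Cmod (phi z) <= 1) ->
  CV_disc t -> CV_disc u -> (forall z, Cmod z < 1 -> (phi z * CPSeries u z)%C = CPSeries t z) ->
  square_sum 1 t (S m) <= square_sum 1 u m.
Proof.
  intros Hphi H0 Hb Ht Hu He.
  apply Rnot_lt_le. intros Hlt.
  set (h := fun r => square_sum r t (S m) - square_sum r u m).
  assert (Hc : continuity_pt h 1).
  { apply continuity_pt_minus; apply square_sum_cont. }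
  assert (Hh : 0 < h 1) by (unfold h; lra).
  destruct (Hc (h 1) Hh) as [d [Hd K]].
  set (r := Rmax 0 (1 - d / 2)).
  assert (Hr : 0 <= r < 1) by (unfold r; split; [apply Rmax_l|apply Rmax_lub_lt; lra]).
  assert (Hr2 : 1 - d / 2 <= r) by (unfold r; apply Rmax_r).
  specialize (K r). simpl in K. unfold R_dist in K.
  assert (Hle := clunie_radius phi t u r m Hphi H0 Hb Ht Hu He Hr).
  assert (Rabs (h r - h 1) < h 1).
  { apply K. split; [split; [exact I|lra]|]. rewrite Rabs_left; lra. }
  apply Rabs_def2 in H. unfold h in H at 2. unfold h in Hh. unfold h in H. lra.
Qed.

(** * Coefficient bounds *)

(* Taylor coefficients of [(1 + B z) ^ (D / B)], or of [exp (D z)] if [B = 0]. *)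
Fixpoint binom_coef (D B : R) (k : nat) : R :=
  match k with O => 1 | S j => binom_coef D B j * ((D - B * INR j) / INR (S j)) end.

Lemma binom_coef_pos (D B : R) (m : nat) :
  (forall k, (k < m)%nat -> 0 < D - B * INR k) -> 0 < binom_coef D B m.
Proof.
  induction m as [|m IH]; intros H; cbn [binom_coef]; [lra|].
  apply Rmult_lt_0_compat; [apply IH; intros k Hk; apply H; lia|].
  apply Rdiv_lt_0_compat; [apply H; lia|apply lt_0_INR; lia].
Qed.

(** With D = (A - B) (p - beta), the numerator of the factor j is D - B (j - 1): the factor j is the
    step from index j - 1 to j. *)
Lemma prod_binom_coef (p : nat) (A B beta : R) (N : nat) :
  prod_f_SO (fun j : nat => (A * (INR p - beta) - B * (INR p - beta + INR j - 1)) / INR j) N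
  = binom_coef ((A - B) * (INR p - beta)) B (S N).
Proof.
  induction N as [|N IH]; [simpl; field|].
  cbn [prod_f_R0]. rewrite IH. cbn [binom_coef]. rewrite (S_INR (S N)).
  f_equal. field. generalize (pos_INR (S N)). lra.
Qed.

Fixpoint weighted_sum (w x : nat -> R) (m : nat) : R :=
  match m with O => 0 | S k => weighted_sum w x k + w k ^ 2 * x k ^ 2 end.

Lemma square_sum_weighted (w : nat -> R) (c : nat -> C) (m : nat) :
  square_sum 1 (fun k => RtoC (w k) * c k)%C m = weighted_sum w (fun k => Cmod (c k)) m.
Proof.
  induction m as [|m IH]; trivial. cbn [square_sum weighted_sum].
  rewrite IH, Cmod_mult, Cmod_R, pow1, Rmult_1_r, Rpow_mult_distr, <- (pow2_abs (w m)).
  reflexivity.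
Qed.

(* [(k + 1)^2 b_{k+1}^2 = (D - B k)^2 b_k^2] makes the sum telescope. *)
Lemma weighted_sum_binom_coef (D B : R) (m : nat) :
  weighted_sum (fun k => D - B * INR k) (binom_coef D B) m - weighted_sum INR (binom_coef D B) m
  = INR m ^ 2 * binom_coef D B m ^ 2.
Proof.
  induction m as [|m IH]; [simpl; ring|].
  cbn [weighted_sum].
  match goal with |- ?a + ?b - (?c + ?d) = _ =>
    replace (a + b - (c + d)) with (a - c + (b - d)) by ring end.
  rewrite IH. cbn [binom_coef].
  assert (INR (S m) <> 0) by (apply not_0_INR; lia).
  field. assumption.
Qed.

Lemma le_of_sq_le (x y : R) : 0 <= y -> x ^ 2 <= y ^ 2 -> x <= y.
Proof. intros Hy H. nra. Qed.

(** The terms ((D - B k)^2 - k^2) x_k^2 with k >= 1 are nonpositive, so the term D^2 at k = 0 bounds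
    the whole difference. For m = 0 no other term occurs; the condition on D - B is guarded
    accordingly, so that (i) is covered as well. *)
Lemma coef_bound_decr (D B : R) (x : nat -> R) :
  0 < D -> -1 <= B <= 1 -> x 0%nat = 1 ->
  (forall m, weighted_sum INR x (S m) <= weighted_sum (fun k => D - B * INR k) x m) ->
  forall m, ((0 < m)%nat -> D - B <= 1) -> INR (S m) * x (S m) <= D.
Proof.
  intros HD HB Hx0 Hw m Hm.
  assert (H : weighted_sum (fun k => D - B * INR k) x (S m)
    - weighted_sum INR x (S m) <= D ^ 2).
  { induction m as [|m IH].
    - simpl. rewrite Hx0. right. ring.
    - set (K := S m) in *. cbn [weighted_sum].
      assert (HK : D - B <= 1) by (apply Hm; unfold K; lia).
      assert (HK1 : 1 <= INR K).
      { unfold K. rewrite S_INR. generalize (pos_INR m). lra. }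
      assert (IH' := IH ltac:(intros; exact HK)).
      (* D - B K = (D - B) - B (K - 1) <= 1 + (K - 1) because B >= -1; the lower bound -K comes from
         D > 0 and B <= 1. *)
      assert (Hs : (D - B * INR K) ^ 2 <= INR K ^ 2).
      { assert (D - B * INR K <= INR K) by nra. assert (- INR K <= D - B * INR K) by nra. nra. }
      assert (H2 := pow2_ge_0 (x K)).
      assert (H3 : (D - B * INR K) ^ 2 * x K ^ 2 <= INR K ^ 2 * x K ^ 2)
        by now apply Rmult_le_compat_r.
      lra. }
  specialize (Hw (S m)). cbn [weighted_sum] in Hw, H.
  apply le_of_sq_le; [lra|]. rewrite Rpow_mult_distr. lra.
Qed.

(** All factors (D - B k)^2 - k^2 with k < n are nonnegative, so by strong induction replacing each
    x_k by [binom_coef D B k] only enlarges the difference of the two sums. It then telescopes to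
    exactly the square of the desired bound, multiplied by (m + 1)^2. *)
Lemma coef_bound_incr (D B : R) (x : nat -> R) (n : nat) :
  0 < D -> -1 <= B <= 1 -> x 0%nat = 1 ->
  (forall m, weighted_sum INR x (S m) <= weighted_sum (fun k => D - B * INR k) x m) ->
  (forall k, (k < n)%nat -> INR k < D - B * INR k) -> (forall k, 0 <= x k) ->
  forall m, (m <= n)%nat -> x m <= binom_coef D B m.
Proof.
  intros HD HB Hx0 Hw Hn Hx m. induction m as [m IH] using (well_founded_induction Nat.lt_wf_0).
  intros Hm. destruct m as [|m]; [rewrite Hx0; simpl; lra|].
  assert (Hb : forall k, (k <= n)%nat -> 0 < binom_coef D B k).
  { intros k Hk. apply binom_coef_pos. intros j Hj.
    eapply Rle_lt_trans; [apply pos_INR|apply Hn; lia]. }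
  assert (H : forall K, (K <= S m)%nat -> weighted_sum (fun k => D - B * INR k) x K
    - weighted_sum INR x K <= INR K ^ 2 * binom_coef D B K ^ 2).
  { intros K HK. rewrite <- weighted_sum_binom_coef.
    induction K as [|K IHK]; [simpl; lra|]. cbn [weighted_sum].
    specialize (IHK ltac:(lia)).
    assert (Hxb : x K ^ 2 <= binom_coef D B K ^ 2).
    { apply pow_incr. split; [apply Hx|]. apply IH; lia. }
    assert (HK2 : 0 <= (D - B * INR K) ^ 2 - INR K ^ 2).
    { assert (H1 := Hn K ltac:(lia)). assert (H2 := pos_INR K). nra. }
    assert (((D - B * INR K) ^ 2 - INR K ^ 2) * x K ^ 2
      <= ((D - B * INR K) ^ 2 - INR K ^ 2) * binom_coef D B K ^ 2)
      by now apply Rmult_le_compat_l.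
    lra. }
  specialize (H (S m) (le_n _)). specialize (Hw (S m)).
  cbn [weighted_sum] in Hw, H.
  assert (HS : 0 < INR (S m)) by (apply lt_0_INR; lia).
  apply le_of_sq_le; [left; now apply Hb|].
  apply Rmult_le_reg_l with (INR (S m) ^ 2); [now apply pow_lt|]. lra.
Qed.

(** The coefficients of f z / z^p. Index 0 carries the normalisation 1 whatever [a p] is, since
    [has_expansion] does not constrain [a p]. *)
Definition coefs (p : nat) (a : nat -> C) (k : nat) : C :=
  match k with O => RtoC 1 | S j => a (S j + p)%nat end.

Lemma Cpow_0_l (n : nat) : (1 <= n)%nat -> (RtoC 0 ^ n)%C = RtoC 0.
Proof. intros H. destruct n as [|n]; [lia|]. rewrite Cpow_S. ring. Qed.

Lemma expansion_series (p : nat) (a : nat -> C) (f : C -> C) :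
  has_expansion p a f -> forall z, z <> RtoC 0 -> Cmod z < 1 ->
  is_CSeries (fun k => coefs p a k * z ^ k)%C (f z / z ^ p)%C.
Proof.
  intros H z Hz0 Hz.
  assert (Hzp := Cpow_nz z p Hz0).
  assert (H1 := is_CSeries_scal (/ z ^ p)%C _ _ (H z Hz)).
  apply (is_CSeries_val _ (RtoC 1 * z ^ 0 + / z ^ p * (f z - z ^ p))%C).
  { simpl. cfield. exact Hzp. }
  apply (is_CSeries_decr (fun k => coefs p a k * z ^ k)%C).
  eapply is_CSeries_ext; [|exact H1].
  intros n. cbv beta. rewrite Cpow_add_r. cbn [coefs].
  cfield. exact Hzp.
Qed.

Lemma expansion_CV_disc (p : nat) (a : nat -> C) (f : C -> C) :
  has_expansion p a f -> CV_disc (coefs p a).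
Proof.
  intros H. apply (CV_disc_of_is_CSeries _ (fun z => f z / z ^ p)%C). now apply expansion_series.
Qed.

Lemma expansion_factor (p : nat) (a : nat -> C) (f : C -> C) : (1 <= p)%nat ->
  has_expansion p a f -> forall z, Cmod z < 1 -> f z = (z ^ p * CPSeries (coefs p a) z)%C.
Proof.
  intros Hp H z Hz. destruct (Ceq_dec z (RtoC 0)) as [->|Hz0].
  - rewrite Cpow_0_l, Cmult_0_l by trivial.
    assert (H0 := H (RtoC 0) Hz).
    apply (is_CSeries_ext _ (fun k => RtoC 0 * RtoC 0)%C) in H0.
    2:{ intros n. rewrite Cpow_0_l by lia. ring. }
    assert (H1 := is_CSeries_unique _ _ H0). rewrite Cpow_0_l in H1 by trivial.
    (* At z = 0 every term of the expansion vanishes. Scaling by 0 leaves this series unchanged, so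
       its sum, which is f 0, is 0. *)
    assert (H2 : CSeries (fun _ => RtoC 0 * RtoC 0)%C = (RtoC 0 * CSeries (fun _ => RtoC 0 * RtoC 0))%C).
    { apply is_CSeries_unique.
      eapply is_CSeries_ext; [|apply is_CSeries_scal; rewrite (is_CSeries_unique _ _ H0); exact H0].
      intros n. cring. }
    rewrite H1 in H2. replace (f (RtoC 0)) with (f 0 - 0)%C by ring. rewrite H2. ring.
  - assert (E := is_CSeries_unique _ _ (expansion_series p a f H z Hz0 Hz)).
    unfold CPSeries. rewrite E. cfield. now apply Cpow_nz.
Qed.

Lemma one_plus_nz (B : R) (w : C) : -1 <= B <= 1 -> Cmod w < 1 -> (1 + RtoC B * w)%C <> RtoC 0.
Proof.
  intros HB Hw H.
  assert (E : (RtoC B * w)%C = (- (1))%C).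
  { replace (RtoC B * w)%C with (1 + RtoC B * w - 1)%C by ring. rewrite H. ring. }
  assert (E1 : Cmod (RtoC B * w) = 1) by (rewrite E, Cmod_opp; apply Cmod_1).
  rewrite Cmod_mult, Cmod_R in E1.
  assert (Rabs B <= 1) by (apply Rabs_le; lra).
  assert (Hw0 := Cmod_ge_0 w). assert (HB0 := Rabs_pos B). nra.
Qed.

(** Splitting off the value p at the origin cancels p B in the numerator and isolates D. *)
Lemma superordinate_eq (p : nat) (A B beta : R) (w : C) : -1 <= B <= 1 -> Cmod w < 1 ->
  superordinate p A B beta w =
  (RtoC (INR p) + RtoC ((A - B) * (INR p - beta)) * w / (1 + RtoC B * w))%C.
Proof.
  intros HB Hw. assert (H := one_plus_nz B w HB Hw).
  unfold superordinate. rewrite RtoC_plus, (RtoC_mult (INR p) B).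
  cfield. exact H.
Qed.

Lemma Cder_monomial_mult (p : nat) (F : C -> C) (z l : C) : (1 <= p)%nat ->
  z <> RtoC 0 -> Cder F z l ->
  Cder (fun w => w ^ p * F w)%C z (z ^ p * F z * (RtoC (INR p) / z) + z ^ p * l)%C.
Proof.
  intros Hp Hz HF. eapply Cder_eq; [apply Cder_mult; [apply Cder_pow|exact HF]|].
  destruct p as [|p]; [lia|]. replace (S p - 1)%nat with p by lia.
  rewrite Cpow_S. cfield. exact Hz.
Qed.

Lemma class_S_sums (p : nat) (A B beta : R) (f : C -> C) (a : nat -> C) :
  (1 <= p)%nat -> -1 <= B -> B < A -> A <= 1 -> beta < 1 ->
  class_S p A B beta f -> has_expansion p a f ->
  let x := fun k => Cmod (coefs p a k) in
  forall m, weighted_sum INR x (S m)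
    <= weighted_sum (fun k => (A - B) * (INR p - beta) - B * INR k) x m.
Proof.
  intros Hp HB HAB HA Hbeta [_ [Hf0 [_ [_ [phi [_ [Hphi0 [Hphi1 Hsub]]]]]]]] Ha x m.
  set (D := (A - B) * (INR p - beta)) in *.
  assert (Hp1 : 1 <= INR p) by (now apply (le_INR 1)).
  assert (HD : 0 < D) by (unfold D; apply Rmult_lt_0_compat; lra).
  assert (HB1 : -1 <= B <= 1) by lra.
  set (c := coefs p a) in *.
  assert (Hc : CV_disc c) by now apply (expansion_CV_disc p a f).
  set (t := fun k => (RtoC (INR k) * c k)%C).
  set (u := fun k => (RtoC (D - B * INR k) * c k)%C).
  assert (Ht : CV_disc t) by now apply CV_disc_index_mult.
  assert (Hu' : forall k, (RtoC D * c k + RtoC (- B) * t k)%C = u k).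
  { intros k. unfold u, t, Rminus. rewrite RtoC_plus, !RtoC_opp, RtoC_mult. ring. }
  assert (Hu : CV_disc u).
  { apply (CV_disc_ext _ _ Hu'). apply CV_disc_plus; now apply CV_disc_scal. }
  assert (Htz : forall z, Cmod z < 1 -> CPSeries t z = (z * CPSeries (CPS_derive c) z)%C).
  { intros z Hz. now apply CPSeries_index_mult. }
  assert (Huz : forall z, Cmod z < 1 -> CPSeries u z = (RtoC D * CPSeries c z - RtoC B * CPSeries t z)%C).
  { intros z Hz. rewrite <- (CPSeries_ext _ _ z Hu'), CPSeries_plus, !CPSeries_scal; trivial;
      try now apply CV_disc_scal. rewrite RtoC_opp. ring. }
  assert (Hfc := expansion_factor p a f Hp Ha). fold c in Hfc.
  (* The value at 0 is 1; elsewhere a zero would be a zero of f = z^p [CPSeries c]. *)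
  assert (Hc0 : forall z, Cmod z < 1 -> CPSeries c z <> RtoC 0).
  { intros z Hz. destruct (Ceq_dec z (RtoC 0)) as [->|Hz0].
    - rewrite CPSeries_0; trivial. exact C1_nz.
    - intros E. apply (Hf0 z Hz Hz0). rewrite Hfc, E by trivial. ring. }
  assert (Hmain : forall z, Cmod z < 1 -> (phi z * CPSeries u z)%C = CPSeries t z).
  { intros z Hz. destruct (Ceq_dec z (RtoC 0)) as [->|Hz0].
    - rewrite Hphi0, Htz by trivial. ring.
    - assert (Hs := Hsub z Hz). rewrite superordinate_eq in Hs by auto.
      fold D in Hs. unfold log_quotient in Hs.
      destruct (Ceq_dec z (RtoC 0)) as [|_]; [contradiction|].
      assert (Hd : C_derive f z = (z ^ p * CPSeries c z * (RtoC (INR p) / z)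
        + z ^ p * CPSeries (CPS_derive c) z)%C).
      { apply Cder_C_derive.
        apply (Cder_ext_loc (fun w => w ^ p * CPSeries c w)%C f z _ (1 - Cmod z)); [lra| |].
        - intros w Hw. symmetry. apply Hfc. replace w with (z + (w - z))%C by ring.
          eapply Rle_lt_trans; [apply Cmod_triangle|]. lra.
        - apply Cder_monomial_mult; trivial. now apply CPSeries_der. }
      assert (H1 := one_plus_nz B _ HB1 (Hphi1 z Hz)).
      assert (Hzp := Cpow_nz z p Hz0). assert (Hcz := Hc0 z Hz).
      rewrite Hd, Hfc in Hs by trivial.
      (* z f' / f is p plus the left side, by the product rule, and p plus the right side, by
         subordination. Clearing denominators gives the identity for [phi]. *)
      assert (E : (CPSeries t z / CPSeries c z)%C = (RtoC D * phi z / (1 + RtoC B * phi z))%C).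
      { rewrite Htz by trivial.
        replace (z * CPSeries (CPS_derive c) z / CPSeries c z)%C with
          (z * (z ^ p * CPSeries c z * (INR p / z) + z ^ p * CPSeries (CPS_derive c) z)
            / (z ^ p * CPSeries c z) - RtoC (INR p))%C by (cfield; repeat split; assumption).
        rewrite Hs. ring. }
      rewrite Huz by trivial.
      assert (E2 : (CPSeries t z * (1 + RtoC B * phi z))%C = (RtoC D * phi z * CPSeries c z)%C).
      { replace (CPSeries t z) with (CPSeries t z / CPSeries c z * CPSeries c z)%C at 1 by (cfield; assumption).
        rewrite E. cfield. assumption. }
      replace (phi z * (RtoC D * CPSeries c z - RtoC B * CPSeries t z))%C
        with (RtoC D * phi z * CPSeries c z - RtoC B * phi z * CPSeries t z)%C by ring.
      rewrite <- E2. ring. }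
  (* A zero of [CPSeries u] would be a zero of [CPSeries t] = phi [CPSeries u], hence of D
     [CPSeries c]. *)
  assert (Hu0 : forall z, Cmod z < 1 -> CPSeries u z <> RtoC 0).
  { intros z Hz E. assert (E1 := Hmain z Hz). rewrite E, Cmult_0_r in E1.
    rewrite Huz, <- E1 in E by trivial.
    apply (Cmult_neq_0 (RtoC D) (CPSeries c z)).
    - apply Cmod_gt_0. rewrite Cmod_R, Rabs_pos_eq; lra.
    - now apply Hc0.
    - rewrite <- E. ring. }
  assert (HphiC1 : disc_C1 phi).
  { apply (disc_C1_ext (fun z => CPSeries t z / CPSeries u z)%C).
    - intros z Hz. rewrite <- Hmain by trivial. cfield. now apply Hu0.
    - apply disc_C1_div; trivial; now apply disc_C1_CPSeries. }
  unfold x. rewrite <- !square_sum_weighted.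
  apply (clunie phi t u m); trivial. intros z Hz. left. now apply Hphi1.
Qed.

(** * The complex exponential *)

Definition Cexp (z : C) : C := (RtoC (exp (Re z)) * cis (Im z))%C.

Lemma cis_plus (s t : R) : cis (s + t) = (cis s * cis t)%C.
Proof.
  unfold cis, Cmult; simpl. rewrite cos_plus, sin_plus. f_equal; ring.
Qed.

Lemma Cexp_plus (z w : C) : Cexp (z + w) = (Cexp z * Cexp w)%C.
Proof.
  unfold Cexp. rewrite re_plus, im_plus, exp_plus, cis_plus, RtoC_mult. ring.
Qed.

Lemma Cexp_0 : Cexp (RtoC 0) = RtoC 1.
Proof.
  unfold Cexp, cis, Re, Im, RtoC, Cmult; simpl. rewrite exp_0, cos_0, sin_0. f_equal; ring.
Qed.

Lemma Cmod_Cexp (z : C) : Cmod (Cexp z) = exp (Re z).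
Proof.
  unfold Cexp. rewrite Cmod_circle. apply Rabs_pos_eq. left. apply exp_pos.
Qed.

Lemma Cexp_nz (z : C) : Cexp z <> RtoC 0.
Proof. apply Cmod_gt_0. rewrite Cmod_Cexp. apply exp_pos. Qed.

Lemma Cexp_opp (z : C) : (Cexp z * Cexp (- z))%C = RtoC 1.
Proof. rewrite <- Cexp_plus, <- Cexp_0. f_equal. ring. Qed.

Lemma Cexp_pow (n : nat) (z : C) : (Cexp z ^ n)%C = Cexp (RtoC (INR n) * z).
Proof.
  induction n as [|n IH].
  - simpl. rewrite Cmult_0_l. symmetry. apply Cexp_0.
  - rewrite Cpow_S, IH, <- Cexp_plus. f_equal. rewrite S_INR, RtoC_plus. ring.
Qed.

Lemma Cder_Cexp_0 : Cder Cexp (RtoC 0) (RtoC 1).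
Proof.
  intros eps Heps.
  assert (Hexp : is_derive exp 0 1) by (auto_derive; trivial; rewrite exp_0; ring).
  assert (Hcis : curve_der cis 0 Ci).
  { split; unfold cis, Re, Im, Ci; simpl; auto_derive; trivial; rewrite ?sin_0, ?cos_0; ring. }
  (* The three error terms below are at most 2 e q, e q and e q, so eps / 6 leaves room; e <= 1
     keeps exp x <= 2. *)
  set (e := Rmin 1 (eps / 6)).
  assert (He : 0 < e) by (apply Rmin_pos; lra).
  assert (He1 : e <= 1) by apply Rmin_l. assert (He6 : e <= eps / 6) by apply Rmin_r.
  destruct (proj1 (is_derive_R_iff _ _ _) Hexp e He) as [d1 [Hd1 H1]].
  destruct (proj1 (curve_der_iff _ _ _) Hcis e He) as [d2 [Hd2 H2]].
  exists (Rmin (Rmin d1 d2) (e / 2)). split; [repeat apply Rmin_pos; lra|].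
  intros w Hw. apply Rmin_Rgt_l in Hw. destruct Hw as [Hw W3].
  apply Rmin_Rgt_l in Hw. destruct Hw as [W1 W2].
  replace (w - 0)%C with w in * by ring.
  set (x := Re w). set (y := Im w). set (q := Cmod w) in *.
  assert (Hx : Rabs x <= q) by apply re_le_Cmod.
  assert (Hy : Rabs y <= q) by apply Im_le_Cmod.
  assert (Hq : 0 <= q) by apply Cmod_ge_0.
  specialize (H1 x). rewrite Rminus_0_r, exp_0 in H1. specialize (H1 ltac:(lra)).
  specialize (H2 y). rewrite Rminus_0_r in H2. specialize (H2 ltac:(lra)).
  replace (cis 0) with (RtoC 1) in H2 by (unfold cis; now rewrite cos_0, sin_0).
  rewrite Rmult_1_r in H1.
  assert (Hex1 : Rabs (exp x - 1) <= e).
  { replace (exp x - 1) with ((exp x - 1 - x) + x) by ring.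
    eapply Rle_trans; [apply Rabs_triang|].
    assert (e * Rabs x <= e * (1 / 2)) by (apply Rmult_le_compat_l; lra). lra. }
  assert (Hex : exp x <= 2) by (apply Rabs_le_between in Hex1; lra).
  assert (Hwxy : w = (RtoC x + Ci * RtoC y)%C).
  { unfold x, y. destruct w as [a b].
    unfold Re, Im, RtoC, Ci, Cplus, Cmult; simpl. f_equal; ring. }
  replace (Cexp w - Cexp 0 - w * 1)%C with
    (RtoC (exp x) * (cis y - 1 - RtoC y * Ci)
     + (RtoC (exp x - 1 - x) + RtoC (exp x - 1) * (RtoC y * Ci)))%C.
  2:{ rewrite Cexp_0. rewrite Hwxy at 2. unfold Cexp. fold x y.
      rewrite !RtoC_minus. ring. }
  eapply Rle_trans; [apply Cmod_triangle|].
  eapply Rle_trans; [apply Rplus_le_compat_l, Cmod_triangle|].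
  rewrite !Cmod_mult, !Cmod_R, Cmod_Ci, (Rabs_pos_eq (exp x)) by (left; apply exp_pos).
  assert (P1 : exp x * Cmod (cis y - 1 - RtoC y * Ci) <= 2 * (e * q)).
  { apply Rmult_le_compat; trivial; try apply Cmod_ge_0; [left; apply exp_pos|].
    eapply Rle_trans; [exact H2|]. apply Rmult_le_compat_l; lra. }
  assert (P2 : Rabs (exp x - 1 - x) <= e * q).
  { eapply Rle_trans; [exact H1|]. apply Rmult_le_compat_l; lra. }
  assert (P3 : Rabs (exp x - 1) * (Rabs y * 1) <= e * q).
  { rewrite Rmult_1_r. apply Rmult_le_compat; trivial; apply Rabs_pos. }
  assert (e * q <= eps / 6 * q) by (apply Rmult_le_compat_r; lra).
  assert (0 <= eps * q) by (apply Rmult_le_pos; lra). lra.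
Qed.

Lemma Cder_Cexp (z : C) : Cder Cexp z (Cexp z).
Proof.
  apply (Cder_ext_loc (fun w => Cexp z * Cexp (w - z))%C Cexp z _ 1); [lra| |].
  - intros w _. rewrite <- Cexp_plus. f_equal. ring.
  - eapply Cder_eq.
    + apply Cder_scal. apply (Cder_comp Cexp (fun w => w - z)%C).
      * replace (z - z)%C with (RtoC 0) by ring. apply Cder_Cexp_0.
      * apply Cder_minus; [apply Cder_id|apply Cder_const].
    + cring.
Qed.

Lemma cis_eq (s t : R) : cis s = cis t -> exists k : Z, s = t + 2 * IZR k * PI.
Proof.
  intros H. unfold cis in H. injection H. intros Hs Hc.
  assert (H1 : cos (s - t) = 1).
  { rewrite cos_minus, Hs, Hc. generalize (sin2_cos2 t). unfold Rsqr. lra. }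
  replace (s - t) with (2 * ((s - t) / 2)) in H1 by field.
  rewrite cos_2a_sin in H1.
  destruct (sin_eq_0_0 ((s - t) / 2)) as [k Hk]; [nra|].
  exists k. lra.
Qed.

Lemma Cexp_eq (z w : C) : Cexp z = Cexp w ->
  exists k : Z, z = (w + RtoC (2 * IZR k * PI) * Ci)%C.
Proof.
  intros H.
  assert (Hre : Re z = Re w).
  { apply exp_inv. rewrite <- !Cmod_Cexp. now rewrite H. }
  destruct (cis_eq (Im z) (Im w)) as [k Hk].
  { unfold Cexp in H. rewrite Hre in H.
    assert (He : RtoC (exp (Re w)) <> RtoC 0).
    { apply Cmod_gt_0. rewrite Cmod_R. apply Rabs_pos_lt, Rgt_not_eq, exp_pos. }
    replace (cis (Im z)) with (/ RtoC (exp (Re w)) * (RtoC (exp (Re w)) * cis (Im z)))%C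
      by (cfield; exact He).
    rewrite H. cfield. exact He. }
  exists k. destruct z as [x y], w as [x' y']. unfold Re, Im in *. simpl in *.
  unfold RtoC, Ci, Cmult, Cplus; simpl. f_equal; rewrite ?Hre, ?Hk; ring.
Qed.

Lemma Cexp_2kPI (k : Z) : Cexp (RtoC (2 * IZR k * PI) * Ci) = RtoC 1.
Proof.
  unfold Cexp. rewrite re_mult_Ci, im_RtoC, Ropp_0, exp_0, Cmult_1_l.
  replace (Im (RtoC (2 * IZR k * PI) * Ci)) with (2 * (IZR k * PI)).
  2:{ unfold Im, RtoC, Ci, Cmult; simpl. ring. }
  assert (H : sin (IZR k * PI) = 0) by (apply sin_eq_0_1; now exists k).
  unfold cis. rewrite cos_2a_sin, sin_2a, H. unfold RtoC. f_equal; ring.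
Qed.

Lemma Cexp_surj (z : C) : z <> RtoC 0 -> exists w : C, Cexp w = z.
Proof.
  intros Hz. assert (Hm := proj1 (Cmod_gt_0 z) Hz).
  set (m := Cmod z) in *. set (a := Re z / m). set (b := Im z / m).
  assert (Hab : a ^ 2 + b ^ 2 = 1).
  { unfold a, b. replace ((Re z / m) ^ 2 + (Im z / m) ^ 2)
      with ((Re z ^ 2 + Im z ^ 2) / m ^ 2) by (field; lra).
    rewrite <- Cmod2_alt. fold m. field. lra. }
  assert (Ha : -1 <= a <= 1) by nra.
  (* [acos a] gives the points of the upper half circle; the sign of b decides between it and its
     opposite. *)
  assert (Ht : exists t, cis t = (a, b)).
  { assert (Hsq : sqrt (1 - Rsqr a) = Rabs b).
    { rewrite <- sqrt_Rsqr_abs. f_equal. unfold Rsqr. lra. }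
    destruct (Rle_lt_dec 0 b) as [Hb|Hb].
    - exists (acos a). unfold cis. rewrite cos_acos, sin_acos, Hsq, Rabs_pos_eq; trivial.
    - exists (- acos a). unfold cis.
      rewrite cos_neg, sin_neg, cos_acos, sin_acos, Hsq, Rabs_left, Ropp_involutive; trivial. }
  destruct Ht as [t Ht].
  exists (ln m, t). unfold Cexp. simpl Re. simpl Im. rewrite exp_ln, Ht by trivial.
  destruct z as [x y]. unfold a, b, Re, Im, RtoC, Cmult; simpl. f_equal; field; lra.
Qed.

(** * Holomorphic functions along segments *)

Lemma curve_der_line (a v : C) (s : R) : curve_der (fun s => a + RtoC s * v)%C s v.
Proof.
  apply curve_der_iff. intros eps Heps. exists 1. split; [lra|]. intros u _.
  replace (a + RtoC u * v - (a + RtoC s * v) - RtoC (u - s) * v)%C with (RtoC 0).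
  - rewrite Cmod_0. apply Rmult_le_pos; [lra|apply Rabs_pos].
  - rewrite RtoC_minus. ring.
Qed.

Lemma disc_constant (W : C -> C) :
  (forall z, Cmod z < 1 -> Cder W z (RtoC 0)) ->
  forall z, Cmod z < 1 -> W z = W (RtoC 0).
Proof.
  intros H z Hz.
  assert (Hc : forall s, 0 <= s <= 1 ->
    curve_der (fun s => W (RtoC 0 + RtoC s * z)%C) s (RtoC 0 * z)%C).
  { intros s Hs. apply (curve_der_comp W (fun s => RtoC 0 + RtoC s * z)%C);
      [|apply curve_der_line].
    apply H. rewrite Cplus_0_l, Cmod_mult, Cmod_R, Rabs_pos_eq by lra.
    generalize (Cmod_ge_0 z). nra. }
  rewrite Cmult_0_l in Hc.
  assert (E0 : (RtoC 0 + RtoC 0 * z)%C = RtoC 0) by ring.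
  assert (E1 : (RtoC 0 + RtoC 1 * z)%C = z) by ring.
  assert (HR := eq_is_derive (fun s => Re (W (RtoC 0 + RtoC s * z)%C)) 0 1
    (fun s Hs => proj1 (Hc s Hs)) Rlt_0_1).
  assert (HI := eq_is_derive (fun s => Im (W (RtoC 0 + RtoC s * z)%C)) 0 1
    (fun s Hs => proj2 (Hc s Hs)) Rlt_0_1).
  cbv beta in HR, HI. rewrite E0, E1 in HR, HI.
  destruct (W z), (W (RtoC 0)). unfold Re, Im in *. simpl in *. now subst.
Qed.

(* The Noshiro-Warschawski theorem on a half plane. *)
Lemma left_half_plane_injective (Phi dPhi : C -> C) :
  (forall z, Re z < 0 -> Cder Phi z (dPhi z)) ->
  (forall z, Re z < 0 -> 0 < Re (dPhi z)) ->
  forall z w, Re z < 0 -> Re w < 0 -> Phi z = Phi w -> z = w.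
Proof.
  intros Hd Hp z w Hz Hw E.
  destruct (Ceq_dec z w) as [|Hne]; trivial. exfalso.
  set (v := (w - z)%C).
  assert (Hv : 0 < Cmod v).
  { apply Cmod_gt_0. intros E0. apply Hne. symmetry. now apply Ceq_minus. }
  set (c := fun s => (z + RtoC s * v)%C).
  assert (Hc : forall s, 0 <= s <= 1 -> Re (c s) < 0).
  { intros s Hs. unfold c, v, Cminus. rewrite re_plus, re_scal_l, re_plus, re_opp. nra. }
  (* Multiplying by the conjugate of the direction v turns the derivative along the segment into
     |v|^2 Re [dPhi], which is positive. By convexity the segment stays in the half plane. *)
  assert (Hder : forall s, 0 <= s <= 1 -> is_derive (fun s => Re (Cconj v * Phi (c s))%C) s
    (Cmod v ^ 2 * Re (dPhi (c s)))).
  { intros s Hs.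
    replace (Cmod v ^ 2 * Re (dPhi (c s))) with (Re (Cconj v * dPhi (c s) * v)%C).
    2:{ replace (Cconj v * dPhi (c s) * v)%C with (v * Cconj v * dPhi (c s))%C by ring.
        rewrite <- Cmod2_conj. apply re_scal_l. }
    apply (curve_der_comp (fun x => Cconj v * Phi x)%C c); [|apply curve_der_line].
    apply Cder_scal. apply Hd. now apply Hc. }
  destruct (MVT_gen (fun s => Re (Cconj v * Phi (c s))%C) 0 1
    (fun s => Cmod v ^ 2 * Re (dPhi (c s)))) as [s [Hs Es]].
  - intros s Hs. rewrite Rmin_left, Rmax_right in Hs by lra. apply Hder. lra.
  - intros s Hs. rewrite Rmin_left, Rmax_right in Hs by lra.
    apply derivable_continuous_pt. eexists. apply is_derive_Reals. apply Hder. lra.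
  - rewrite Rmin_left, Rmax_right in Hs by lra.
    assert (E0 : c 0 = z) by (unfold c; ring).
    assert (E1 : c 1 = w) by (unfold c, v; ring).
    cbv beta in Es. rewrite E0, E1, E in Es.
    assert (0 < Cmod v ^ 2 * Re (dPhi (c s))).
    { apply Rmult_lt_0_compat; [now apply pow_lt|]. apply Hp. now apply Hc. }
    lra.
Qed.

(** * The extremal functions *)

Lemma bounded_of_eventually_decr (u : nat -> R) (N : nat) :
  (forall k, (N <= k)%nat -> u (S k) <= u k) -> exists M, forall k, u k <= M.
Proof.
  intros H.
  assert (Hn : forall n, exists M, forall k, (k <= n)%nat -> u k <= M).
  { induction n as [|n [M HM]].
    - exists (u 0%nat). intros k Hk. replace k with 0%nat by lia. lra.
    - exists (Rmax M (u (S n))). intros k Hk. destruct (Nat.eq_dec k (S n)) as [->|].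
      + apply Rmax_r.
      + eapply Rle_trans; [apply HM; lia|apply Rmax_l]. }
  destruct (Hn N) as [M HM]. exists M. intros k.
  destruct (Nat.le_gt_cases k N) as [Hk|Hk]; [now apply HM|].
  apply Rle_trans with (u N); [|now apply HM].
  induction Hk as [|k Hk IH]; [apply H; lia|].
  eapply Rle_trans; [apply H; lia|exact IH].
Qed.

(** * The binomial series and its logarithm *)

Section BinomialSeries.

Variables (delta B : R).
Hypothesis delta_pos : 0 < delta.
Hypothesis B_bound : -1 <= B <= 1.

Definition power_coef (k : nat) : C := RtoC (binom_coef delta B k).
(** Taylor coefficients of (delta / B) log (1 + B z). The formula remains valid for B = 0, where it
    gives delta z. *)
Definition log_coef (k : nat) : C :=
  match k with O => RtoC 0 | S j => RtoC (delta * (- B) ^ j / INR (S j)) end.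

Lemma CV_disc_power_coef : CV_disc power_coef.
Proof.
  intros r Hr.
  (* The ratio of consecutive terms is at most r (delta + k) / (k + 1), which is at most 1 once k (1
     - r) >= r delta. *)
  destruct (nfloor_ex (r * delta / (1 - r))) as [N HN].
  { apply Rmult_le_pos; [nra|]. left. apply Rinv_0_lt_compat. lra. }
  apply (bounded_of_eventually_decr _ (S N)). intros k Hk.
  unfold power_coef. rewrite !Cmod_R. cbn [binom_coef pow]. rewrite Rabs_mult.
  assert (HS : 0 < INR (S k)) by (apply lt_0_INR; lia).
  rewrite Rabs_div, (Rabs_pos_eq (INR (S k))) by lra.
  set (b := Rabs (binom_coef delta B k)). assert (Hb : 0 <= b) by apply Rabs_pos.
  assert (Hrk : 0 <= r ^ k) by (apply pow_le; lra).
  assert (Hq : r * (Rabs (delta - B * INR k) / INR (S k)) <= 1).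
  { apply Rmult_le_reg_r with (INR (S k)); trivial.
    replace (r * (Rabs (delta - B * INR k) / INR (S k)) * INR (S k))
      with (r * Rabs (delta - B * INR k)) by (field; lra).
    assert (HkN : INR (S N) <= INR k) by now apply le_INR.
    rewrite S_INR in HkN. rewrite S_INR, Rmult_1_l.
    assert (Hk0 := pos_INR k).
    assert (Habs : Rabs (delta - B * INR k) <= delta + INR k).
    { apply Rabs_le. nra. }
    assert (H1 : r * delta / (1 - r) * (1 - r) <= INR k * (1 - r)).
    { apply Rmult_le_compat_r; lra. }
    unfold Rdiv in H1. rewrite Rmult_assoc, Rinv_l in H1 by lra. nra. }
  replace (b * (Rabs (delta - B * INR k) / INR (S k)) * (r * r ^ k))
    with ((r * (Rabs (delta - B * INR k) / INR (S k))) * (b * r ^ k)) by ring.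
  assert (0 <= b * r ^ k) by now apply Rmult_le_pos. nra.
Qed.

Lemma CV_disc_log_coef : CV_disc log_coef.
Proof.
  intros r Hr. exists delta. intros k.
  assert (Hk1 : r ^ k <= 1) by (rewrite <- (pow1 k); apply pow_incr; lra).
  assert (Hk0 : 0 <= r ^ k) by (apply pow_le; lra).
  assert (Hl : Cmod (log_coef k) <= delta).
  { destruct k as [|k]; unfold log_coef; [rewrite Cmod_0; lra|].
    rewrite Cmod_R, Rabs_div by (apply not_0_INR; lia).
    rewrite Rabs_mult, <- RPow_abs, (Rabs_pos_eq delta), Rabs_Ropp by lra.
    rewrite (Rabs_pos_eq (INR (S k))) by apply pos_INR.
    assert (HB : Rabs B <= 1) by (apply Rabs_le; lra).
    assert (HBk : Rabs B ^ k <= 1).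
    { rewrite <- (pow1 k). apply pow_incr. split; [apply Rabs_pos|exact HB]. }
    assert (HS : 1 <= INR (S k)) by (rewrite S_INR; generalize (pos_INR k); lra).
    apply Rmult_le_reg_r with (INR (S k)); [lra|].
    unfold Rdiv. rewrite Rmult_assoc, Rinv_l by lra.
    assert (0 <= Rabs B ^ k) by apply pow_le, Rabs_pos. nra. }
  assert (H0 := Cmod_ge_0 (log_coef k)). nra.
Qed.

Definition power_fun (z : C) : C := CPSeries power_coef z.
Definition power_fun' (z : C) : C := CPSeries (CPS_derive power_coef) z.
Definition log_fun (z : C) : C := CPSeries log_coef z.
Definition log_fun' (z : C) : C := CPSeries (CPS_derive log_coef) z.

(** Coefficientwise this is the recursion of [binom_coef]: (n + 1) b_{n+1} + B n b_n = delta b_n. *)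
Lemma power_fun_ode (z : C) : Cmod z < 1 -> ((1 + RtoC B * z) * power_fun' z)%C = (RtoC delta * power_fun z)%C.
Proof.
  intros Hz. assert (HF := CV_disc_power_coef). assert (HD := CV_disc_derive _ HF).
  assert (HI := CV_disc_index_mult _ HF).
  transitivity (CPSeries (fun n => CPS_derive power_coef n + RtoC B * (RtoC (INR n) * power_coef n))%C z).
  - rewrite CPSeries_plus, CPSeries_scal, CPSeries_index_mult; trivial; [|now apply CV_disc_scal].
    unfold power_fun'. ring.
  - unfold power_fun. rewrite <- CPSeries_scal by trivial. apply CPSeries_ext. intros n.
    unfold CPS_derive, power_coef. cbn [binom_coef]. rewrite <- !RtoC_mult, <- RtoC_plus. f_equal.
    field. apply not_0_INR. lia.
Qed.

(** The derived coefficients delta (- B)^n are geometric: a shift of the index multiplies them by -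
    B. *)
Lemma log_fun_ode (z : C) : Cmod z < 1 -> ((1 + RtoC B * z) * log_fun' z)%C = RtoC delta.
Proof.
  intros Hz. assert (HD := CV_disc_derive _ CV_disc_log_coef).
  assert (Hn : forall n, CPS_derive log_coef n = RtoC (delta * (- B) ^ n)).
  { intros n. unfold CPS_derive, log_coef. rewrite <- RtoC_mult. f_equal. field. apply not_0_INR. lia. }
  assert (E : log_fun' z = (RtoC delta - RtoC B * z * log_fun' z)%C).
  { unfold log_fun' at 1. rewrite CPSeries_split by trivial.
    rewrite (CPSeries_ext _ (fun n => RtoC (- B) * CPS_derive log_coef n)%C).
    - rewrite CPSeries_scal, Hn by trivial. simpl. rewrite Rmult_1_r, RtoC_opp.
      unfold log_fun'. ring.
    - intros n. rewrite !Hn, <- RtoC_mult, Nat.add_1_r. f_equal. simpl. ring. }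
  replace ((1 + RtoC B * z) * log_fun' z)%C with (log_fun' z + RtoC B * z * log_fun' z)%C by ring.
  rewrite E at 1. ring.
Qed.

(** By the two differential equations, [power_fun] times the exponential of - [log_fun] has
    derivative 0. This supplies a logarithm of [power_fun] on the whole disc without choosing
    branches, and shows that it has no zeros. *)
Lemma power_fun_exp (z : C) : Cmod z < 1 -> power_fun z = Cexp (log_fun z).
Proof.
  intros Hz.
  set (W := fun z => (power_fun z * Cexp (- log_fun z))%C).
  assert (HW : W z = W (RtoC 0)).
  { apply disc_constant; trivial. clear z Hz. intros z Hz.
    assert (H1 := one_plus_nz B z B_bound Hz).
    assert (HF := CPSeries_der _ _ CV_disc_power_coef Hz). assert (HL := CPSeries_der _ _ CV_disc_log_coef Hz).
    eapply Cder_eq.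
    - apply Cder_mult; [exact HF|].
      apply (Cder_comp Cexp (fun w => - log_fun w)%C); [apply Cder_Cexp|].
      apply Cder_opp. exact HL.
    - cbv beta. fold (power_fun' z) (log_fun' z) (power_fun z).
      assert (E : (power_fun' z - power_fun z * log_fun' z)%C = RtoC 0).
      { assert (E0 : ((1 + RtoC B * z) * (power_fun' z - power_fun z * log_fun' z))%C = RtoC 0).
        { transitivity ((1 + RtoC B * z) * power_fun' z - power_fun z * ((1 + RtoC B * z) * log_fun' z))%C; [ring|].
          rewrite power_fun_ode, log_fun_ode by trivial. ring. }
        destruct (Ceq_dec (power_fun' z - power_fun z * log_fun' z)%C (RtoC 0)) as [|Hne]; trivial.
        exfalso. now apply (Cmult_neq_0 _ _ H1 Hne). }
      transitivity (Cexp (- log_fun z) * (power_fun' z - power_fun z * log_fun' z))%C; [ring|].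
      rewrite E. ring. }
  assert (H0 : W (RtoC 0) = RtoC 1).
  { unfold W, power_fun, log_fun. rewrite !CPSeries_0 by (apply CV_disc_power_coef || apply CV_disc_log_coef).
    unfold power_coef, log_coef. simpl. replace (- 0)%C with (RtoC 0) by ring.
    rewrite Cexp_0. ring. }
  rewrite H0 in HW. unfold W in HW.
  transitivity (power_fun z * Cexp (- log_fun z) * Cexp (log_fun z))%C.
  - rewrite <- Cmult_assoc, (Cmult_comm (Cexp (- log_fun z))), Cexp_opp. ring.
  - rewrite HW. ring.
Qed.

Lemma power_fun_nz (z : C) : Cmod z < 1 -> power_fun z <> RtoC 0.
Proof. intros Hz. rewrite power_fun_exp by trivial. apply Cexp_nz. Qed.

Lemma power_fun_log_deriv (z : C) : Cmod z < 1 -> (power_fun' z / power_fun z)%C = (RtoC delta / (1 + RtoC B * z))%C.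
Proof.
  intros Hz. assert (H1 := one_plus_nz B z B_bound Hz). assert (H2 := power_fun_nz z Hz).
  transitivity ((1 + RtoC B * z) * power_fun' z / ((1 + RtoC B * z) * power_fun z))%C.
  - cfield. split; assumption.
  - rewrite power_fun_ode by trivial. cfield. split; assumption.
Qed.

End BinomialSeries.

Lemma Cmod_pow_lt_1 (z : C) (m : nat) : (1 <= m)%nat -> Cmod z < 1 -> Cmod (z ^ m) < 1.
Proof.
  intros Hm Hz. rewrite Cmod_pow. destruct m as [|m]; [lia|].
  assert (H0 := Cmod_ge_0 z). assert (Cmod z ^ m <= 1).
  { rewrite <- (pow1 m). apply pow_incr. lra. }
  simpl. assert (0 <= Cmod z ^ m) by now apply pow_le. nra.
Qed.

(* With [x = Re w] and [q = |w|]: if [x + B q^2 < 0], the worst case is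
   [D = (1 - B) p], where the numerator is at least [p (1 - q) (1 - B q)]. *)
Lemma Re_half_plane (p D B : R) (w : C) :
  0 < p -> 0 < D -> D <= (1 - B) * p -> -1 <= B <= 1 -> Cmod w < 1 ->
  0 < Re (RtoC p + RtoC D * w / (1 + RtoC B * w)).
Proof.
  intros Hp HD HDp HB Hw. assert (H1 := one_plus_nz B w HB Hw).
  set (u := (1 + RtoC B * w)%C) in *. set (x := Re w). set (q := Cmod w) in *.
  assert (Hq := Cmod_ge_0 w). fold q in Hq.
  assert (Hu := proj1 (Cmod_gt_0 u) H1).
  assert (Hu2 : 0 < Cmod u ^ 2) by now apply pow_lt.
  assert (Hq2 : q ^ 2 = x ^ 2 + Im w ^ 2) by apply Cmod2_alt.
  assert (Ru : Re u = 1 + B * x) by (unfold u; now rewrite re_plus, re_scal_l, re_RtoC).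
  assert (Iu : Im u = B * Im w) by (unfold u; rewrite im_plus, im_scal_l, im_RtoC; ring).
  assert (Eu : Cmod u ^ 2 = 1 + 2 * B * x + B ^ 2 * q ^ 2).
  { rewrite Cmod2_alt, Hq2, Ru, Iu. ring. }
  assert (E : Re (RtoC p + RtoC D * w / u) = (p * Cmod u ^ 2 + D * (x + B * q ^ 2)) / Cmod u ^ 2).
  { replace (RtoC p + RtoC D * w / u)%C
      with (RtoC (/ (Cmod u ^ 2)) * (RtoC (p * Cmod u ^ 2) + RtoC D * (w * Cconj u)))%C.
    - rewrite re_scal_l, re_plus, re_scal_l, re_mult, re_conj, im_conj, re_RtoC.
      rewrite Ru, Iu. fold x. rewrite Hq2. field. lra.
    - assert (Hc : Cconj u <> RtoC 0).
      { apply Cmod_gt_0. now rewrite Cmod_conj. }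
      rewrite RtoC_inv by lra. rewrite RtoC_mult, Cmod2_conj. cfield. split; assumption. }
  rewrite E. apply Rdiv_lt_0_compat; trivial.
  destruct (Rle_lt_dec 0 (x + B * q ^ 2)) as [Hs|Hs]; [nra|].
  assert (Hxq : - q <= x).
  { assert (H := re_le_Cmod w). apply Rabs_le_between in H. apply H. }
  assert (Hlow : (1 - B) * p * (x + B * q ^ 2) <= D * (x + B * q ^ 2)) by nra.
  apply Rlt_le_trans with (p * ((1 - q) * (1 - B * q))).
  - apply Rmult_lt_0_compat; trivial. apply Rmult_lt_0_compat; nra.
  (* The bracket collapses to 1 + (1 + B) x + B q^2, which is nondecreasing in x and equals (1 - q)
     (1 - B q) at x = - q. *)
  - apply Rle_trans with (p * (Cmod u ^ 2 + (1 - B) * (x + B * q ^ 2))); [|nra].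
    apply Rmult_le_compat_l; [lra|]. rewrite Eu. nra.
Qed.

(** Coefficients of the series in z obtained by substituting z^m into the series with coefficients
    u. *)
Definition spread (m : nat) (u : nat -> C) (n : nat) : C :=
  if (n mod m =? 0)%nat then u (n / m)%nat else RtoC 0.

Lemma sum_n_spread (m : nat) (u : nat -> C) (N : nat) : (1 <= m)%nat ->
  @sum_n C_AbelianMonoid (spread m u) N = @sum_n C_AbelianMonoid u (N / m).
Proof.
  intros Hm. induction N as [|N IH].
  - rewrite Nat.Div0.div_0_l, !sum_O. unfold spread.
    now rewrite Nat.Div0.mod_0_l, Nat.Div0.div_0_l.
  - rewrite sum_Sn, IH. unfold spread.
    assert (H1 := Nat.div_mod_eq N m). assert (H2 := Nat.mod_upper_bound N m ltac:(lia)).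
    assert (H3 := Nat.div_mod_eq (S N) m).
    assert (H4 := Nat.mod_upper_bound (S N) m ltac:(lia)).
    destruct (S N mod m =? 0)%nat eqn:E.
    + apply Nat.eqb_eq in E. rewrite E in H3.
      replace (S N / m)%nat with (S (N / m)) by nia.
      now rewrite sum_Sn.
    + apply Nat.eqb_neq in E. replace (S N / m)%nat with (N / m)%nat by nia.
      apply (@plus_zero_r C_AbelianMonoid).
Qed.

Lemma is_CSeries_spread (m : nat) (u : nat -> C) (l : C) : (1 <= m)%nat ->
  is_CSeries u l -> is_CSeries (spread m u) l.
Proof.
  intros Hm H. apply filterlim_locally. intros eps.
  destruct (proj1 (filterlim_locally _ _) H eps) as [N HN].
  exists (m * N)%nat. intros n Hn. rewrite sum_n_spread by trivial. apply HN.
  apply Nat.div_le_lower_bound; lia.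
Qed.

Lemma disc_C1_pow (n : nat) : disc_C1 (fun z => z ^ n)%C.
Proof.
  induction n as [|n IH]; [exact (disc_C1_const 1)|].
  apply (disc_C1_mult (fun z => z)); [apply disc_C1_id|exact IH].
Qed.

(** * Multiplicities of solutions *)

Definition prod_factors (s : list C) (z : C) : C :=
  fold_right Cmult (RtoC 1) (map (fun c => z - c)%C s).

Lemma prod_factors_perm (s s' : list C) (z : C) :
  Permutation s s' -> prod_factors s z = prod_factors s' z.
Proof.
  intros H. unfold prod_factors. induction H as [|x s s' H IH|x y s|s s' s'' H IH H' IH'].
  - reflexivity.
  - simpl. now rewrite IH.
  - simpl. ring.
  - now rewrite IH.
Qed.

Lemma prod_factors_0 (s : list C) (c : C) : In c s -> prod_factors s c = RtoC 0.
Proof.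
  intros H. unfold prod_factors. induction s as [|x s IH]; [destruct H|].
  simpl. destruct H as [->|H]; [ring|]. rewrite IH by trivial. ring.
Qed.

Lemma prod_factors_der (s : list C) (z : C) : exists l, Cder (prod_factors s) z l.
Proof.
  induction s as [|x s [l IH]]; [eexists; apply (Cder_const (RtoC 1))|].
  eexists. apply (Cder_mult (fun z => z - x)%C (prod_factors s)); [|exact IH].
  apply Cder_minus; [apply Cder_id|apply Cder_const].
Qed.

(** Bringing a repeated entry to the front exhibits a factor (z - c)^2 of the product. *)
Lemma not_NoDup_perm (s : list C) : ~ NoDup s -> exists c t, Permutation s (c :: c :: t).
Proof.
  induction s as [|x s IH]; intros H; [exfalso; apply H; constructor|].
  destruct (classic (In x s)) as [Hx|Hx].
  - destruct (in_split x s Hx) as [l1 [l2 ->]]. exists x, (l1 ++ l2).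
    constructor. symmetry. apply Permutation_middle.
  - destruct IH as [c [t Ht]].
    { intros Hs. apply H. now constructor. }
    exists c, (x :: t). rewrite Ht.
    transitivity (c :: x :: c :: t); [constructor|]. constructor. constructor.
Qed.

Lemma Cmod_Cexp_lt_1 (zeta : C) : Re zeta < 0 <-> Cmod (Cexp zeta) < 1.
Proof.
  rewrite Cmod_Cexp. split; intros H.
  - rewrite <- exp_0. now apply exp_increasing.
  - apply exp_lt_inv. now rewrite exp_0.
Qed.

(** * Logarithmic derivative, logarithm and valence of the extremal functions *)

Section Extremal.

Variables (p m : nat) (D B : R).
Hypothesis p_pos : (1 <= p)%nat.
Hypothesis m_pos : (1 <= m)%nat.
Hypothesis D_pos : 0 < D.
Hypothesis B_bound : -1 <= B <= 1.
Hypothesis D_bound : D <= (1 - B) * INR p.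

(** The chain rule for z^m contributes a factor m to z f' / f; dividing D by m compensates for
    it. *)
Let delta : R := D / INR m.

Definition extremal (z : C) : C := (z ^ p * power_fun delta B (z ^ m))%C.

Definition extremal_coef (n : nat) : C :=
  spread m (fun k => RtoC (binom_coef delta B k)) (n - p).

Definition log_deriv (z : C) : C := (RtoC (INR p) + RtoC D * z ^ m / (1 + RtoC B * z ^ m))%C.

Lemma INR_m_pos : 0 < INR m.
Proof. apply lt_0_INR. lia. Qed.

Lemma delta_pos : 0 < delta.
Proof. apply Rdiv_lt_0_compat; [exact D_pos|exact INR_m_pos]. Qed.

Lemma disc_pow (z : C) : Cmod z < 1 -> Cmod (z ^ m) < 1.
Proof. now apply Cmod_pow_lt_1. Qed.

Lemma extremal_expansion : has_expansion p extremal_coef extremal.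
Proof.
  intros z Hz. unfold unit_disc in Hz.
  assert (H := CPSeries_correct _ _ (CV_disc_power_coef delta B delta_pos B_bound) (disc_pow z Hz)).
  fold (power_fun delta B (z ^ m)) in H.
  apply (is_CSeries_spread m _ _ m_pos) in H.
  apply (is_CSeries_scal (z ^ p)) in H. apply is_CSeries_incr in H. fold (extremal z) in H.
  eapply is_CSeries_val; [|eapply is_CSeries_ext; [|exact H]].
  - cbv beta. fold (extremal z). unfold spread. rewrite Nat.Div0.mod_0_l, Nat.Div0.div_0_l.
    simpl. unfold power_coef. simpl. unfold extremal. ring.
  - intros n. cbv beta. unfold extremal_coef. rewrite Nat.add_sub, Cpow_add_r.
    unfold spread. destruct (S n mod m =? 0)%nat eqn:E; [|ring].
    apply Nat.eqb_eq in E. assert (H1 := Nat.div_mod_eq (S n) m). rewrite E, Nat.add_0_r in H1.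
    replace (z ^ S n)%C with ((z ^ m) ^ (S n / m))%C by (now rewrite <- Cpow_mult_r, <- H1).
    unfold power_coef. ring.
Qed.

Lemma Cder_F_pow (z : C) : Cmod z < 1 ->
  Cder (fun z => power_fun delta B (z ^ m)) z
    (power_fun' delta B (z ^ m) * (RtoC (INR m) * z ^ (m - 1)))%C.
Proof.
  intros Hz. apply (Cder_comp (power_fun delta B) (fun z => z ^ m)%C).
  - apply CPSeries_der; [|now apply disc_pow]. apply CV_disc_power_coef; [apply delta_pos|exact B_bound].
  - apply Cder_pow.
Qed.

Lemma holomorphic_F_pow : holomorphic_on_disc (fun z => power_fun delta B (z ^ m)).
Proof. intros z Hz. eexists. apply is_derive_Cder. now apply Cder_F_pow. Qed.

Lemma holomorphic_extremal : holomorphic_on_disc extremal.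
Proof.
  intros z Hz. eexists. apply is_derive_Cder.
  apply Cder_mult; [apply Cder_pow|now apply Cder_F_pow].
Qed.

Lemma F_pow_nz (z : C) : Cmod z < 1 -> power_fun delta B (z ^ m) <> RtoC 0.
Proof. intros Hz. apply power_fun_nz; [apply delta_pos|exact B_bound|now apply disc_pow]. Qed.

Lemma extremal_nz (z : C) : Cmod z < 1 -> z <> RtoC 0 -> extremal z <> RtoC 0.
Proof.
  intros Hz Hz0. apply Cmult_neq_0; [now apply Cpow_nz|now apply F_pow_nz].
Qed.

Lemma Cder_extremal (z : C) : Cmod z < 1 -> z <> RtoC 0 ->
  Cder extremal z (extremal z * log_deriv z / z)%C.
Proof.
  intros Hz Hz0. eapply Cder_eq.
  - apply Cder_monomial_mult; trivial. now apply Cder_F_pow.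
  - assert (H1 := power_fun_log_deriv delta B delta_pos B_bound (z ^ m) (disc_pow z Hz)).
    assert (H2 := F_pow_nz z Hz). assert (H3 := one_plus_nz B _ B_bound (disc_pow z Hz)).
    assert (E : power_fun' delta B (z ^ m) = (power_fun delta B (z ^ m) * (RtoC delta / (1 + RtoC B * z ^ m)))%C).
    { rewrite <- H1. cfield. exact H2. }
    rewrite E. unfold log_deriv, extremal.
    assert (ED : RtoC D = (RtoC delta * RtoC (INR m))%C).
    { rewrite <- RtoC_mult. f_equal. unfold delta. field. apply Rgt_not_eq, INR_m_pos. }
    assert (Em : (z ^ m)%C = (z * z ^ (m - 1))%C).
    { rewrite <- Cpow_S. f_equal. lia. }
    rewrite ED. set (w := (z ^ m)%C) in *. set (v := (z ^ (m - 1))%C) in *.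
    assert (Ev : v = (w / z)%C) by (rewrite Em; cfield; exact Hz0).
    rewrite Ev. cfield. split; assumption.
Qed.

Lemma log_deriv_pos (z : C) : Cmod z < 1 -> 0 < Re (log_deriv z).
Proof.
  intros Hz. apply Re_half_plane; trivial; [|now apply disc_pow].
  apply lt_0_INR. lia.
Qed.

Lemma log_deriv_nz (z : C) : Cmod z < 1 -> log_deriv z <> RtoC 0.
Proof.
  intros Hz E. assert (H := log_deriv_pos z Hz). rewrite E, re_RtoC in H. lra.
Qed.

(* A logarithm of [extremal] in the coordinate [zeta = log z]. *)
Definition log_extremal (zeta : C) : C := (RtoC (INR p) * zeta + log_fun delta B (Cexp zeta ^ m))%C.

Lemma extremal_Cexp (zeta : C) : Re zeta < 0 -> extremal (Cexp zeta) = Cexp (log_extremal zeta).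
Proof.
  intros H. apply Cmod_Cexp_lt_1 in H. unfold extremal, log_extremal.
  rewrite power_fun_exp, Cexp_plus, Cexp_pow; trivial; [exact delta_pos|now apply disc_pow].
Qed.

Lemma log_extremal_der (zeta : C) : Re zeta < 0 -> Cder log_extremal zeta (log_deriv (Cexp zeta)).
Proof.
  intros H. apply Cmod_Cexp_lt_1 in H.
  set (z := Cexp zeta) in *. assert (Hm := disc_pow z H).
  assert (H3 := one_plus_nz B _ B_bound Hm).
  eapply Cder_eq.
  - apply Cder_plus; [apply Cder_scal, Cder_id|].
    apply (Cder_comp (log_fun delta B) (fun w => Cexp w ^ m)%C).
    + apply CPSeries_der; [|exact Hm]. apply CV_disc_log_coef; [exact delta_pos|exact B_bound].
    + apply (Cder_comp (fun w => w ^ m)%C Cexp); [apply Cder_pow|apply Cder_Cexp].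
  - fold z. fold (log_fun' delta B (z ^ m)). unfold log_deriv.
    assert (E : log_fun' delta B (z ^ m) = (RtoC delta / (1 + RtoC B * z ^ m))%C).
    { rewrite <- (log_fun_ode delta B delta_pos B_bound _ Hm). cfield. exact H3. }
    rewrite E.
    assert (ED : RtoC D = (RtoC delta * RtoC (INR m))%C).
    { rewrite <- RtoC_mult. f_equal. unfold delta. field. apply Rgt_not_eq, INR_m_pos. }
    assert (Em : (z ^ m)%C = (z * z ^ (m - 1))%C).
    { rewrite <- Cpow_S. f_equal. lia. }
    rewrite ED. set (w := (z ^ m)%C) in *. set (v := (z ^ (m - 1))%C) in *.
    replace (RtoC delta * RtoC (INR m) * w)%C
      with (RtoC delta * (RtoC (INR m) * (z * v)))%C by (rewrite Em; ring).
    cfield. exact H3.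
Qed.

Lemma log_extremal_injective (z w : C) : Re z < 0 -> Re w < 0 -> log_extremal z = log_extremal w -> z = w.
Proof.
  apply (left_half_plane_injective log_extremal (fun z => log_deriv (Cexp z))).
  - intros u Hu. now apply log_extremal_der.
  - intros u Hu. apply log_deriv_pos. now apply Cmod_Cexp_lt_1.
Qed.

Lemma log_extremal_shift (j : Z) (zeta : C) :
  log_extremal (zeta + RtoC (2 * IZR j * PI) * Ci) =
  (log_extremal zeta + RtoC (2 * IZR (j * Z.of_nat p) * PI) * Ci)%C.
Proof.
  unfold log_extremal. rewrite Cexp_plus, Cexp_2kPI, Cmult_1_r.
  rewrite mult_IZR, <- INR_IZR_INZ.
  replace (2 * (IZR j * INR p) * PI) with (INR p * (2 * IZR j * PI)) by ring.
  rewrite (RtoC_mult (INR p)). ring.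
Qed.

(* The branch of [log c] used does not matter modulo [p]. *)
Definition branch (lam c : C) (k : nat) : Prop :=
  (k < p)%nat /\ exists zeta : C, Cexp zeta = c /\ Re zeta < 0 /\
    exists j : Z, log_extremal zeta = (lam + RtoC (2 * IZR (Z.of_nat k + j * Z.of_nat p) * PI) * Ci)%C.

Lemma branch_exists (lam c : C) : Cmod c < 1 -> c <> RtoC 0 -> extremal c = Cexp lam ->
  exists k, branch lam c k.
Proof.
  intros Hc Hc0 E. destruct (Cexp_surj c Hc0) as [zeta Hz].
  assert (Hre : Re zeta < 0) by (apply Cmod_Cexp_lt_1; now rewrite Hz).
  rewrite <- Hz, extremal_Cexp in E by trivial.
  destruct (Cexp_eq _ _ E) as [k Hk].
  assert (Hp : (0 < Z.of_nat p)%Z) by lia.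
  assert (Hb := Z.mod_pos_bound k _ Hp).
  exists (Z.to_nat (k mod Z.of_nat p)). split; [lia|].
  exists zeta. split; [exact Hz|]. split; [exact Hre|]. exists (k / Z.of_nat p)%Z.
  assert (Ek : (k mod Z.of_nat p + k / Z.of_nat p * Z.of_nat p = k)%Z).
  { assert (H := Z.div_mod k (Z.of_nat p) ltac:(lia)). lia. }
  rewrite Z2Nat.id by lia. now rewrite Ek.
Qed.

Lemma branch_injective (lam c c' : C) (k : nat) : branch lam c k -> branch lam c' k -> c = c'.
Proof.
  intros [_ [z [Hz [Hrez [j Hj]]]]] [_ [w [Hw [Hrew [i Hi]]]]].
  (* Both logarithms have the same residue k, so they differ by a multiple of 2 pi i p, which a
     shift of z by 2 pi i (i - j) absorbs. The shift changes neither [Re z] nor [Cexp z]. *)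
  assert (E : log_extremal (z + RtoC (2 * IZR (i - j) * PI) * Ci) = log_extremal w).
  { rewrite log_extremal_shift, Hj, Hi. rewrite !plus_IZR, !mult_IZR, minus_IZR.
    rewrite <- Cplus_assoc, <- Cmult_plus_distr_r, <- RtoC_plus. do 3 f_equal. ring. }
  apply log_extremal_injective in E; trivial.
  - rewrite <- Hw, <- E, Cexp_plus, Cexp_2kPI, Hz. ring.
  - rewrite re_plus, re_mult_Ci, im_RtoC. lra.
Qed.

(** Choosing a branch index for each solution gives, by [branch_injective], a duplicate-free list of
    the same length inside 0, ..., p - 1. *)
Lemma distinct_solutions_bound (w : C) (s : list C) : w <> RtoC 0 -> NoDup s ->
  (forall c, In c s -> Cmod c < 1 /\ extremal c = w) -> (length s <= p)%nat.
Proof.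
  intros Hw Hs Hsol. destruct (Cexp_surj w Hw) as [lam Hlam].
  assert (H : exists l, length l = length s /\ NoDup l /\
    forall k, In k l -> exists c, In c s /\ branch lam c k).
  { induction Hs as [|c s Hc Hs IH].
    - exists nil. repeat split; [constructor|]. intros k [].
    - destruct IH as [l [Hl [Hnd Hb]]]. { intros c' Hc'. apply Hsol. now right. }
      destruct (Hsol c (or_introl eq_refl)) as [Hc1 Hcw].
      destruct (branch_exists lam c) as [k Hk]; trivial.
      { intros ->. apply Hw. rewrite <- Hcw. unfold extremal.
        rewrite Cpow_0_l by exact p_pos. ring. }
      { now rewrite Hlam. }
      exists (k :: l). split; [simpl; now rewrite Hl|]. split.
      + constructor; trivial. intros Hin. destruct (Hb k Hin) as [c' [Hc' Hk']].
        apply Hc. now rewrite (branch_injective lam c c' k).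
      + intros k' [<-|Hin].
        * exists c. split; [now left|exact Hk].
        * destruct (Hb k' Hin) as [c' [Hc' Hk']]. exists c'. split; [now right|exact Hk']. }
  destruct H as [l [Hl [Hnd Hb]]]. rewrite <- Hl, <- (length_seq p 0).
  apply NoDup_incl_length; trivial. intros k Hk. destruct (Hb k Hk) as [c [_ [Hkp _]]].
  apply in_seq. lia.
Qed.

(* A double root would be a zero of the derivative, which vanishes at most at 0. *)
Lemma solutions_NoDup (w : C) (s : list C) : w <> RtoC 0 -> solutions extremal w s -> NoDup s.
Proof.
  intros Hw [Hs [h [Hh He]]]. apply NNPP. intros Hnd.
  destruct (not_NoDup_perm s Hnd) as [c [t Hp]].
  assert (Hc : Cmod c < 1).
  { rewrite Forall_forall in Hs. apply Hs. apply (Permutation_in c (Permutation_sym Hp)). now left. }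
  assert (He' : forall z, Cmod z < 1 ->
    (extremal z - w)%C = ((z - c) * ((z - c) * (prod_factors t z * h z)))%C).
  { intros z Hz. rewrite (He z Hz). fold (prod_factors s z).
    rewrite (prod_factors_perm _ _ z Hp). unfold prod_factors. simpl. ring. }
  assert (Hcw : extremal c = w).
  { replace (extremal c) with (extremal c - w + w)%C by ring. rewrite He' by trivial. ring. }
  assert (Hc0 : c <> RtoC 0).
  { intros ->. apply Hw. rewrite <- Hcw. unfold extremal.
    rewrite Cpow_0_l by exact p_pos. ring. }
  destruct (Hh c Hc) as [dh Hdh]. apply is_derive_Cder in Hdh.
  destruct (prod_factors_der t c) as [dt Hdt].
  assert (H1 : Cder (fun z => extremal z - w)%C c (extremal c * log_deriv c / c - 0)%C).
  { apply Cder_minus; [now apply Cder_extremal|apply Cder_const]. }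
  (* By the product rule every term of the derivative keeps a factor z - c. *)
  assert (H2 : Cder (fun z => extremal z - w)%C c (RtoC 0)).
  { apply (Cder_ext_loc (fun z => (z - c) * ((z - c) * (prod_factors t z * h z)))%C
      _ c _ (1 - Cmod c)); [lra| |].
    - intros z Hz. symmetry. apply He'. replace z with (c + (z - c))%C by ring.
      eapply Rle_lt_trans; [apply Cmod_triangle|]. lra.
    - assert (Hzc : Cder (fun z => z - c)%C c (RtoC 1 - RtoC 0)%C)
        by (apply Cder_minus; [apply Cder_id|apply Cder_const]).
      eapply Cder_eq.
      + apply Cder_mult; [exact Hzc|]. apply Cder_mult; [exact Hzc|].
        apply Cder_mult; [exact Hdt|exact Hdh].
      + cring. }
  assert (E := Cder_unique _ _ _ _ H1 H2).
  assert (Hl := log_deriv_nz c Hc). rewrite Hcw in E.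
  apply (Cmult_neq_0 w (log_deriv c) Hw Hl).
  transitivity ((w * log_deriv c / c - 0) * c)%C; [cfield; exact Hc0|].
  rewrite E. ring.
Qed.

(** Every entry is 0, so the product is a power of z. If its exponent exceeded p, dividing by z^p
    would leave a positive power of z times h equal to F (z^m) away from 0; letting z tend to 0
    contradicts F 0 = 1. *)
Lemma solutions_0_bound (s : list C) : solutions extremal (RtoC 0) s -> (length s <= p)%nat.
Proof.
  intros [Hs [h [Hh He]]].
  assert (H0 : forall c, In c s -> c = RtoC 0).
  { intros c Hc. apply NNPP. intros Hc0.
    assert (Hc1 : Cmod c < 1) by (rewrite Forall_forall in Hs; now apply Hs).
    apply (extremal_nz c Hc1 Hc0).
    replace (extremal c) with (extremal c - 0)%C by ring.
    rewrite (He c Hc1). fold (prod_factors s c). rewrite prod_factors_0 by trivial. ring. }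
  assert (Hprod : forall z, prod_factors s z = (z ^ length s)%C).
  { intros z. clear Hs He. induction s as [|c s IH]; trivial.
    unfold prod_factors in *. simpl. rewrite IH by (intros c' Hc'; apply H0; now right).
    rewrite (H0 c) by now left. ring. }
  apply Nat.nlt_ge. intros Hlt.
  set (j := (length s - p - 1)%nat).
  assert (Hj : length s = (p + S j)%nat) by (unfold j; lia).
  (* This function is 0 on the punctured disc and -1 at the origin, against its continuity. *)
  set (g := fun z => (z ^ S j * h z - power_fun delta B (z ^ m))%C).
  assert (Hg : forall z, Cmod z < 1 -> z <> RtoC 0 -> g z = RtoC 0).
  { intros z Hz Hz0. assert (E := He z Hz). fold (prod_factors s z) in E.
    rewrite Hprod, Hj, Cpow_add_r in E. unfold extremal in E.
    assert (Hzp := Cpow_nz z p Hz0). unfold g.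
    apply Cmod_eq_0. apply Rmult_eq_reg_l with (Cmod (z ^ p)).
    - rewrite <- Cmod_mult, Rmult_0_r, <- Cmod_0. f_equal.
      transitivity (z ^ p * z ^ S j * h z - (z ^ p * power_fun delta B (z ^ m) - 0))%C; [ring|].
      rewrite E. ring.
    - apply Rgt_not_eq. now apply Cmod_gt_0. }
  assert (H01 : Cmod (RtoC 0) < 1) by (rewrite Cmod_0; lra).
  assert (Hg0 : g (RtoC 0) = (- (1))%C).
  { unfold g. rewrite !Cpow_0_l by lia. unfold power_fun. rewrite CPSeries_0.
    - unfold power_coef. simpl. ring.
    - apply CV_disc_power_coef; [exact delta_pos|exact B_bound]. }
  destruct (Hh _ H01) as [dh Hdh]. apply is_derive_Cder in Hdh.
  assert (Hc : Ccont g (RtoC 0)).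
  { eapply Cder_cont. apply Cder_minus; [|now apply Cder_F_pow].
    apply Cder_mult; [apply Cder_pow|exact Hdh]. }
  destruct (Hc 1 Rlt_0_1) as [d [Hd K]].
  set (x := Rmin (1 / 2) (d / 2)).
  assert (Hx : 0 < x) by (apply Rmin_pos; lra).
  assert (Hx1 : x <= 1 / 2) by apply Rmin_l. assert (Hx2 : x <= d / 2) by apply Rmin_r.
  assert (Hmx : Cmod (RtoC x) = x) by (rewrite Cmod_R; apply Rabs_pos_eq; lra).
  specialize (K (RtoC x)). replace (RtoC x - 0)%C with (RtoC x) in K by ring.
  rewrite Hmx, Hg0, Hg in K.
  - replace (0 - - (1))%C with (RtoC 1) in K by ring. rewrite Cmod_1 in K.
    specialize (K ltac:(lra)). lra.
  - rewrite Hmx. lra.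
  - apply Cmod_gt_0. lra.
Qed.

Lemma p_valent_extremal : p_valent p extremal.
Proof.
  split.
  - intros w s Hs. destruct (Ceq_dec w (RtoC 0)) as [->|Hw]; [now apply solutions_0_bound|].
    apply (distinct_solutions_bound w); trivial; [now apply (solutions_NoDup w)|].
    destruct Hs as [Hs [h [_ He]]]. rewrite Forall_forall in Hs.
    intros c Hc. assert (Hc1 : Cmod c < 1) by now apply Hs. split; trivial.
    replace (extremal c) with (extremal c - w + w)%C by ring.
    rewrite (He c Hc1). fold (prod_factors s c). rewrite prod_factors_0 by trivial. ring.
  (* The value 0 is taken p times at the origin, with cofactor F (z^m). *)
  - exists (RtoC 0), (repeat (RtoC 0) p). split; [|apply repeat_length]. split.
    + apply Forall_forall. intros c Hc. apply repeat_spec in Hc. subst c.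
      unfold unit_disc. rewrite Cmod_0. lra.
    + exists (fun z => power_fun delta B (z ^ m)). split; [apply holomorphic_F_pow|].
      intros z _. unfold extremal.
      assert (E : forall q, prod_factors (repeat (RtoC 0) q) z = (z ^ q)%C).
      { unfold prod_factors. induction q as [|q IH]; trivial. simpl. rewrite IH. ring. }
      fold (prod_factors (repeat (RtoC 0) p) z). rewrite E. ring.
Qed.

End Extremal.

(** * Membership of the extremal functions in the class *)

Lemma class_S_extremal (p m : nat) (A B beta : R) :
  (1 <= p)%nat -> (1 <= m)%nat -> -1 <= B -> B < A -> A <= 1 -> 0 <= beta -> beta < 1 ->
  class_S p A B beta (extremal p m ((A - B) * (INR p - beta)) B).
Proof.
  intros Hp Hm HB HAB HA Hb0 Hb1. set (D := (A - B) * (INR p - beta)).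
  assert (Hp1 : 1 <= INR p) by (now apply (le_INR 1)).
  assert (HD : 0 < D) by (unfold D; apply Rmult_lt_0_compat; lra).
  assert (HB1 : -1 <= B <= 1) by lra.
  assert (HDp : D <= (1 - B) * INR p) by (unfold D; apply Rmult_le_compat; lra).
  assert (Hlog : forall z, Cmod z < 1 ->
    log_quotient p (extremal p m D B) z = superordinate p A B beta (z ^ m)).
  { intros z Hz. rewrite superordinate_eq by (trivial; now apply Cmod_pow_lt_1).
    fold D. fold (log_deriv p m D B z). unfold log_quotient.
    destruct (Ceq_dec z (RtoC 0)) as [->|Hz0].
    - unfold log_deriv. rewrite Cpow_0_l by trivial. cfield.
    - assert (Hd : Cder (extremal p m D B) z (extremal p m D B z * log_deriv p m D B z / z)%C)
        by now apply Cder_extremal.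
      assert (H : extremal p m D B z <> RtoC 0) by now apply extremal_nz.
      rewrite (Cder_C_derive _ _ _ Hd). cfield. split; assumption. }
  (* Applied to z^m for the quotient z f' / f and to z for the superordinate function. By [Hlog] the
     quotient agrees with a rational function on the whole disc, so its removable singularity needs
     no separate argument. *)
  assert (Hsup : forall q : C -> C, disc_C1 q -> (forall z, Cmod z < 1 -> Cmod (q z) < 1) ->
    disc_C1 (fun z => superordinate p A B beta (q z))).
  { intros q Hq Hq1. unfold superordinate. apply disc_C1_div.
    - intros z Hz. apply one_plus_nz; trivial. now apply Hq1.
    - apply disc_C1_plus; [apply disc_C1_const|].
      apply disc_C1_mult; [apply disc_C1_const|exact Hq].
    - apply disc_C1_plus; [apply disc_C1_const|].
      apply disc_C1_mult; [apply disc_C1_const|exact Hq]. }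
  split; [split; [|split]|split].
  - now apply holomorphic_extremal.
  - exists (extremal_coef p m D B). now apply extremal_expansion.
  - now apply p_valent_extremal.
  - intros z Hz Hz0. now apply extremal_nz.
  - split; [|split].
    + apply disc_C1_hol. apply (disc_C1_ext (fun z => superordinate p A B beta (z ^ m)%C)).
      * intros z Hz. symmetry. now apply Hlog.
      * apply Hsup; [apply disc_C1_pow|]. intros z Hz. now apply Cmod_pow_lt_1.
    + apply disc_C1_hol. apply (Hsup (fun z => z)); [apply disc_C1_id|trivial].
    + exists (fun z => z ^ m)%C. split; [apply disc_C1_hol, disc_C1_pow|].
      split; [now apply Cpow_0_l|]. split; [|exact Hlog].
      intros z Hz. now apply Cmod_pow_lt_1.
Qed.

(* [prod_f_SO u N] is the product of [u j] for [1 <= j <= N + 1]. *)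
Theorem theorem2p2 :
  forall (p : nat) (A B beta : R),
    (1 <= p)%nat -> -1 <= B -> B < A -> A <= 1 -> 0 <= beta -> beta < 1 ->
    (* the bounds *)
    (forall (f : C -> C) (a : nat -> C),
       class_S p A B beta f -> has_expansion p a f ->
       Cmod (a (p + 1)%nat) <= (A - B) * (INR p - beta)
       /\
       (A * (INR p - beta) - B * (INR p - beta + 1) <= 1 ->
        forall n : nat, (p + 2 <= n)%nat ->
          Cmod (a n) <= (A - B) * (INR p - beta) / (INR n - INR p))
       /\
       (forall n : nat, (p + 2 <= n)%nat ->
          A * (INR p - beta) - B * (INR n - beta - 1) > INR n - INR p - 1 ->
          Cmod (a n) <=
            prod_f_SO (fun j : nat =>
              (A * (INR p - beta) - B * (INR p - beta + INR j - 1)) / INR j)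
              (n - p - 1)%nat))
    /\
    (* the two forms of the condition in (ii) *)
    (A * (INR p - beta) - B * (INR p - beta + 1) <= 1 <->
     forall n : nat, (p + 2 <= n)%nat ->
       A * (INR p - beta) - B * (INR n - beta - 1) <= INR n - INR p - 1)
    /\
    (* sharpness of (i), (ii) and (iii) *)
    (exists (f : C -> C) (a : nat -> C),
       class_S p A B beta f /\ has_expansion p a f /\
       Cmod (a (p + 1)%nat) = (A - B) * (INR p - beta))
    /\
    (A * (INR p - beta) - B * (INR p - beta + 1) <= 1 ->
     forall n : nat, (p + 2 <= n)%nat ->
       exists (f : C -> C) (a : nat -> C),
         class_S p A B beta f /\ has_expansion p a f /\
         Cmod (a n) = (A - B) * (INR p - beta) / (INR n - INR p))
    /\
    (forall n : nat, (p + 2 <= n)%nat ->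
       A * (INR p - beta) - B * (INR n - beta - 1) > INR n - INR p - 1 ->
       exists (f : C -> C) (a : nat -> C),
         class_S p A B beta f /\ has_expansion p a f /\
         Cmod (a n) =
           prod_f_SO (fun j : nat =>
             (A * (INR p - beta) - B * (INR p - beta + INR j - 1)) / INR j)
             (n - p - 1)%nat).
Proof.
  intros p A B beta Hp HB HAB HA Hbeta0 Hbeta1.
  set (D := (A - B) * (INR p - beta)).
  assert (Hp1 : 1 <= INR p) by (now apply (le_INR 1)).
  assert (HD : 0 < D) by (unfold D; apply Rmult_lt_0_compat; lra).
  assert (HB1 : -1 <= B <= 1) by lra.
  assert (HDp : D <= (1 - B) * INR p) by (unfold D; apply Rmult_le_compat; lra).
  (* With q = n, the conditions of (ii) and (iii) compare D - B k with k for k = n - p - 1. *)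
  assert (Hcond : forall q : R,
    A * (INR p - beta) - B * (q - beta - 1) = D - B * (q - INR p - 1)) by (intros q; unfold D; ring).
  assert (Hcond2 : A * (INR p - beta) - B * (INR p - beta + 1) = D - B) by (unfold D; ring).
  assert (Hn : forall n : nat, (p + 2 <= n)%nat -> exists m, n = (S (S m) + p)%nat).
  { intros n Hn. exists (n - p - 2)%nat. lia. }
  assert (Hsub : forall k : nat, INR (k + p) - INR p = INR k) by (intros k; rewrite plus_INR; ring).
  (* The hypothesis of (iii) at [n = p + m + 2] propagates to every smaller index. *)
  assert (Hincr : forall m : nat, D - B * (INR (S (S m)) - 1) > INR (S (S m)) - 1 ->
    forall k, (k < S (S m))%nat -> INR k < D - B * INR k).
  { intros m Hm k Hk. assert (HkM : INR k <= INR (S m)) by (apply le_INR; lia).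
    rewrite (S_INR (S m)) in Hm.
    replace (INR (S m) + 1 - 1) with (INR (S m)) in Hm by ring. nra. }
  rewrite Hcond2. split; [|split; [split|split; [|split]]].
  - intros f a HS Ha.
    assert (Hw := class_S_sums p A B beta f a Hp HB HAB HA Hbeta1 HS Ha).
    cbv zeta in Hw. fold D in Hw. set (x := fun k => Cmod (coefs p a k)) in Hw.
    assert (Hx0 : x 0%nat = 1) by apply Cmod_1.
    assert (Hx : forall k, x (S k) = Cmod (a (S k + p)%nat)) by reflexivity.
    split; [|split].
    (* At m = 0 the guard 0 < m is false, so no condition on D - B has to be supplied. *)
    + assert (H := coef_bound_decr D B x HD HB1 Hx0 Hw 0 ltac:(lia)).
      rewrite Hx in H. rewrite Nat.add_comm. simpl in H |- *. lra.
    + intros Hc n Hnp. destruct (Hn n Hnp) as [m ->]. rewrite Hsub.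
      assert (H := coef_bound_decr D B x HD HB1 Hx0 Hw (S m) (fun _ => Hc)).
      rewrite Hx in H.
      assert (HS0 : 0 < INR (S (S m))) by (apply lt_0_INR; lia).
      apply Rmult_le_reg_l with (INR (S (S m))); trivial.
      eapply Rle_trans; [exact H|]. right. field. lra.
    + intros n Hnp Hc. destruct (Hn n Hnp) as [m ->]. rewrite Hcond, Hsub in Hc.
      replace (S (S m) + p - p - 1)%nat with (S m) by lia.
      rewrite prod_binom_coef. fold D. rewrite <- Hx.
      apply (coef_bound_incr D B x (S (S m))); trivial.
      * now apply Hincr.
      * intros k. apply Cmod_ge_0.
  (* The case n = p + 2 is the strongest: D - B k <= k follows from D - B <= 1 because (1 + B) (k -
     1) >= 0. *)
  - intros Hc n Hnp. destruct (Hn n Hnp) as [m ->]. rewrite Hcond, Hsub.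
    rewrite !S_INR. assert (H := pos_INR m). nra.
  - intros H. specialize (H (p + 2)%nat (le_n _)). rewrite Hcond, plus_INR in H.
    simpl in H. lra.
  (* For m = 1 the coefficient at z^(p + 1) is [binom_coef D B 1], that is D. *)
  - exists (extremal p 1 D B), (extremal_coef p 1 D B).
    split; [now apply class_S_extremal|]. split; [now apply extremal_expansion|].
    unfold extremal_coef. replace (p + 1 - p)%nat with 1%nat by lia.
    unfold spread. simpl. rewrite Cmod_R, Rabs_pos_eq; [field|].
    rewrite Rmult_0_r, Rminus_0_r, !Rdiv_1_r. lra.
  - intros _ n Hnp. destruct (Hn n Hnp) as [m ->].
    (* Substituting z^(n - p) moves the linear coefficient D / (n - p) of F to the position n. *)
    exists (extremal p (S (S m)) D B), (extremal_coef p (S (S m)) D B).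
    assert (Hm : (1 <= S (S m))%nat) by lia.
    split; [now apply class_S_extremal|]. split; [now apply extremal_expansion|].
    unfold extremal_coef. rewrite Nat.add_sub, Hsub. unfold spread.
    rewrite Nat.Div0.mod_same, Nat.div_same by lia. cbn [Nat.eqb binom_coef].
    assert (HS0 : 0 < INR (S (S m))) by (apply lt_0_INR; lia).
    rewrite Cmod_R, Rabs_pos_eq.
    + change (INR 0) with 0. change (INR 1) with 1. field. lra.
    + change (INR 0) with 0. change (INR 1) with 1.
      rewrite Rmult_0_r, Rminus_0_r, Rdiv_1_r, Rmult_1_l.
      left. now apply Rdiv_lt_0_compat.
  - intros n Hnp Hc. destruct (Hn n Hnp) as [m ->]. rewrite Hcond, Hsub in Hc.
    (* For m = 1 the coefficients are the numbers [binom_coef D B k] themselves; under the condition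
       of (iii) the one at k = n - p is positive, hence equal to its modulus. *)
    exists (extremal p 1 D B), (extremal_coef p 1 D B).
    split; [now apply class_S_extremal|]. split; [now apply extremal_expansion|].
    replace (S (S m) + p - p - 1)%nat with (S m) by lia. rewrite prod_binom_coef. fold D.
    unfold extremal_coef. rewrite Nat.add_sub. unfold spread.
    rewrite Nat.mod_1_r, Nat.div_1_r. cbn [Nat.eqb].
    replace (D / INR 1) with D by (simpl; field).
    rewrite Cmod_R. apply Rabs_pos_eq. left. apply binom_coef_pos.
    intros k Hk. eapply Rle_lt_trans; [apply pos_INR|now apply (Hincr m)].
Qed.
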